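(* Let $G$ be a colorable cactus graph. Then $\chi'_{\mathrm{irr}}(G)\le 4$.
   Context: All graphs are simple and finite. A cactus graph is a graph whose cycles are pairwise edge-disjoint. A graph is locally irregular if the two end-vertices of every edge have distinct degrees. A locally irregular $k$-edge coloring ($k$-liec) of $G$ is an edge coloring with at most $k$ colors in which each color class induces a locally irregular subgraph of $G$. A graph is colorable if it admits a liec with some number of colors, and for colorable $G$, the locally irregular chromatic index $\chi'_{\mathrm{irr}}(G)$ is the smallest $k$ such that $G$ admits a $k$-liec. *)

(* Defs.v *)
From mathcomp Require Import all_boot.

Set Implicit Arguments.
Unset Strict Implicit.
Unset Printing Implicit Defensive.

Record sgraph := SGraph {
  svertex :> finType;
  adj : rel svertex;
  adj_sym : symmetric adj;
  adj_irrefl : irreflexive adj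
}.

Definition edges (G : sgraph) : {set {set G}} :=
  [set [set p.1; p.2] | p : G * G & adj p.1 p.2].

Definition edge (G : sgraph) : finType := {A : {set G} | A \in edges G}.

Definition deg (G : sgraph) (x : G) : nat := #|[set y : G | adj x y]|.

Definition locally_irregular (G : sgraph) : bool :=
  [forall x : G, forall y : G, adj x y ==> (deg x != deg y)].

(* The vertices of a cycle listed in cyclic order: pairwise distinct, at least
   three of them, consecutive ones (and the last and first) adjacent. *)
Definition is_cycle (G : sgraph) (p : seq G) : bool :=
  [&& 3 <= size p, uniq p & cycle (@adj G) p].

Definition cycle_edges (G : sgraph) (p : seq G) : {set {set G}} :=
  [set [set x; next p x] | x in p].

(* A cycle is a subgraph, so two vertex lists describe the same cycle exactly
   when they have the same edge set (rotations and reversals are identified). *)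
Definition cactus (G : sgraph) : Prop :=
  forall p q : seq G, is_cycle p -> is_cycle q ->
    cycle_edges p != cycle_edges q -> [disjoint cycle_edges p & cycle_edges q].

(* The subgraph induced by a set F of edges: its vertices are the ends of the
   edges in F.  The test x != y only matters when F contains singletons, which
   are never edges. *)
Section EdgeInduced.
Variables (G : sgraph) (F : {set {set G}}).

Definition induced_vertex : finType := {x : G | x \in cover F}.

Definition induced_adj : rel induced_vertex :=
  [rel x y | (val x != val y) && ([set val x; val y] \in F)].

Lemma induced_adj_sym : symmetric induced_adj.
Proof. by move=> x y; rewrite /induced_adj /= eq_sym setUC. Qed.

Lemma induced_adj_irrefl : irreflexive induced_adj.
Proof. by move=> x; rewrite /induced_adj /= eqxx. Qed.

Definition edge_induced : sgraph := SGraph induced_adj_sym induced_adj_irrefl.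

End EdgeInduced.

Definition color_class (G : sgraph) (k : nat) (c : {ffun edge G -> 'I_k})
    (i : 'I_k) : {set {set G}} :=
  [set val a | a : edge G & c a == i].

(* Color classes may be empty, so this is a coloring with at most k colors. *)
Definition is_liec (G : sgraph) (k : nat) (c : {ffun edge G -> 'I_k}) : bool :=
  [forall i : 'I_k, locally_irregular (edge_induced (color_class c i))].

Definition has_liec (G : sgraph) (k : nat) : bool :=
  [exists c : {ffun edge G -> 'I_k}, is_liec c].

Definition colorable (G : sgraph) : Prop := exists k : nat, has_liec G k.

Definition chi_irr (G : sgraph) (hG : colorable G) : nat := ex_minn hG.

(* Main.v *)
Require Import Defs.
From mathcomp Require Import all_boot.
From mathcomp Require Import zify.

(* Root each component and take a depth-first tree, so that every other edge (a
   back edge) joins a vertex to an ancestor; in a cactus every tree edge is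
   covered by at most one back edge.  Orient back edges away from the root and
   tree edges so that every vertex except the root has even out-degree.  Give
   each vertex [v] one of four colors and color all edges leaving [v] with it.
   If every vertex differs from its in-neighbours and receives each color an odd
   number of times or never, then along each edge one end has even degree in the
   color of the edge and the other has odd degree.  Such colors can be chosen
   greedily from the root downwards, since at most three of them are ever
   forbidden.

   The out-degree of the root is odd exactly when the component has an odd number
   of edges.  A root of degree at least 3 still works, unless it has degree 3 and
   lies in a triangle such that each edge leaving the triangle leads to a side
   with an odd number of edges.  If all vertices of degree at least 3 are of this
   kind, then a locally irregular coloring forces an even number of edges: in such
   a coloring every edge leaving a triangle has color degree 2 at its outer end
   (induction on the size of the side), whereas a vertex whose three edges share
   a color has a triangle for which this fails. *)

Set Implicit Arguments.
Unset Strict Implicit.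
Unset Printing Implicit Defensive.

(** * Depth-first trees *)

Section RootedTrees.
Variables (G : sgraph) (r : G).
Implicit Types (x y v w a u : G) (p : G -> G) (h : G -> nat).

(* Locked so that [inE] does not unfold membership in a component. *)
Fact component_key : unit. Proof. by []. Qed.
Definition component : {set G} :=
  locked_with component_key [set x | connect (@adj G) r x].

Lemma mem_component x : (x \in component) = connect (@adj G) r x.
Proof. by rewrite [component]unlock inE. Qed.

Lemma component_root : r \in component.
Proof. by rewrite mem_component connect0. Qed.

Lemma component_adj x y : x \in component -> adj x y -> y \in component.
Proof. by rewrite !mem_component => rx /connect1; apply: connect_trans. Qed.

(** Since [r] is a fixed point of [p], the ancestors of a vertex are simply the points of its orbit
    under [p]. Outside the component [p] and [h] are arbitrary. *)
Definition rooted_tree p h : Prop :=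
  [/\ p r = r, h r = 0 &
    forall v, v \in component -> v != r -> adj v (p v) /\ h v = (h (p v)).+1].

Definition anc p a v := fconnect p v a.

Lemma ancP p a v : reflect (exists n, iter n p v = a) (anc p a v).
Proof.
apply: (iffP idP) => [|[n <-]]; last exact: fconnect_iter.
by move/iter_findex; exists (findex p v a).
Qed.

Lemma anc_refl p v : anc p v v.
Proof. exact: connect0. Qed.

Lemma anc_trans p a b v : anc p a b -> anc p b v -> anc p a v.
Proof. by move=> ab bv; apply: connect_trans bv ab. Qed.

Lemma anc_parent p v : anc p (p v) v.
Proof. exact: fconnect1. Qed.

Lemma anc_neq_parent p a v : anc p a v -> a != v -> anc p a (p v).
Proof.
case/ancP=> [[|n]] /= <-; first by rewrite eqxx.
by move=> _; apply/ancP; exists n; rewrite -iterSr.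
Qed.

Lemma anc_total p a b v : anc p a v -> anc p b v -> anc p a b || anc p b a.
Proof.
case/ancP=> m <- /ancP [n <-]; case: (leqP m n) => [le_mn|/ltnW le_nm].
  by apply/orP; right; apply/ancP; exists (n - m); rewrite -iterD subnK.
by apply/orP; left; apply/ancP; exists (m - n); rewrite -iterD subnK.
Qed.

Section Spec.
Variables (p : G -> G) (h : G -> nat).
Hypothesis tree_ph : rooted_tree p h.
Notation C := component.

Lemma tree_root : p r = r. Proof. by case: tree_ph. Qed.
Lemma height_root : h r = 0. Proof. by case: tree_ph. Qed.

Lemma adj_parent v : v \in C -> v != r -> adj v (p v).
Proof. by case: tree_ph => _ _ t vC vr; case: (t v vC vr). Qed.

Lemma height_parent v : v \in C -> v != r -> h v = (h (p v)).+1.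
Proof. by case: tree_ph => _ _ t vC vr; case: (t v vC vr). Qed.

Lemma component_parent v : v \in C -> p v \in C.
Proof.
move=> vC; case: (eqVneq v r) => [->|vr]; first by rewrite tree_root component_root.
exact: component_adj vC (adj_parent vC vr).
Qed.

Lemma component_anc a v : anc p a v -> v \in C -> a \in C.
Proof.
case/ancP=> n <- vC; elim: n => //= n; exact: component_parent.
Qed.

Lemma height_eq0 v : v \in C -> h v = 0 -> v = r.
Proof. by move=> vC; case: (eqVneq v r) => // vr; rewrite height_parent. Qed.

Lemma height_iter n v : v \in C -> h (iter n p v) = h v - n.
Proof.
move=> vC; elim: n => [|n IHn]; first by rewrite subn0.
have iC : iter n p v \in C by apply: component_anc vC; apply: fconnect_iter.
rewrite iterS; case: (eqVneq (iter n p v) r) => [e|ne].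
  by rewrite e tree_root; move: IHn; rewrite e height_root; lia.
by move: IHn; rewrite (height_parent iC ne); lia.
Qed.

Lemma anc_height a v : v \in C -> anc p a v -> a != v -> h a < h v.
Proof.
move=> vC /ancP [n <-] ne; rewrite height_iter //.
case: n ne => [|n]; first by rewrite eqxx.
case: (posnP (h v)) => [/(height_eq0 vC) ->|]; last lia.
by rewrite iter_fix ?tree_root // eqxx.
Qed.

Lemma anc_anti a v : v \in C -> anc p a v -> anc p v a -> a = v.
Proof.
move=> vC av va; apply/eqP/contraT => ne.
have := anc_height vC av ne; have := anc_height (component_anc av vC) va.
by rewrite eq_sym => /(_ ne); lia.
Qed.

Lemma anc_root v : v \in C -> anc p r v.
Proof.
move=> vC; apply/ancP; exists (h v); apply: height_eq0.
  by apply: component_anc vC; apply: fconnect_iter.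
by rewrite height_iter // subnn.
Qed.

(** The [h v + 1] vertices on the tree path from [v] to [r] have distinct heights. *)
Lemma height_bound v : v \in C -> h v < #|G|.
Proof.
move=> vC; have /leq_card : injective (fun i : 'I_(h v).+1 => iter i p v).
  move=> i j /= /(congr1 h); rewrite !height_iter // => e.
  by apply: val_inj => /=; have := ltn_ord i; have := ltn_ord j; lia.
by rewrite card_ord.
Qed.

Definition sub v : {set G} := [set x in C | anc p v x].

Lemma subE v x : x \in C -> (x \in sub v) = anc p v x.
Proof. by move=> xC; rewrite inE xC. Qed.

Lemma mem_sub v : v \in C -> v \in sub v.
Proof. by move=> vC; rewrite inE vC anc_refl. Qed.

End Spec.

(** The characteristic property of depth-first trees: no edge joins two different branches. *)
Definition normal_tree p := forall x y, x \in component -> adj x y ->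
  anc p x y || anc p y x.

(** A breadth-first tree, which serves as the starting point of the maximization below: heights are
    distances from [r], and a parent is any neighbour one step closer. *)
Lemma distance_tree_exists : exists p h, rooted_tree p h.
Proof.
pose P x n := [exists t : n.-tuple G, path (@adj G) r t && (last r t == x)].
(* The implication makes the existence total, so that [ex_minn] gives a height outside the component
   too. *)
have exP x : exists n, (x \in component) ==> P x n.
  case xC: (x \in component); last by exists 0.
  move: xC; rewrite mem_component => /connectP [t pt ->]; exists (size t) => /=.
  by apply/existsP; exists (in_tuple t); rewrite pt eqxx.
pose h x := ex_minn (exP x).
have hP x : x \in component -> P x (h x).
  by rewrite /h; case: ex_minnP => m + _ xC; rewrite xC.
have hmin x n : P x n -> h x <= n.
  by move=> Pn; rewrite /h; case: ex_minnP => m _; apply; rewrite Pn implybT.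
have next v : v \in component -> v != r -> exists w, adj v w && (h v == (h w).+1).
  move=> vC vr; have /existsP [t /andP [pt /eqP lt]] := hP v vC.
  have := size_tuple t; case: (lastP (tval t)) pt lt => [|s z] /=.
    by move=> _ e; rewrite e eqxx in vr.
  rewrite rcons_path last_rcons size_rcons => /andP [ps az] ez sz; subst z.
  exists (last r s); rewrite adj_sym az /= eqn_leq.
  apply/andP; split; last first.
    rewrite -sz ltnS; apply: hmin; apply/existsP.
    by exists (in_tuple s); rewrite ps eqxx.
  have lC : last r s \in component by rewrite mem_component; apply/connectP; exists s.
  have /existsP [t' /andP [pt' /eqP lt']] := hP _ lC.
  apply: hmin; apply/existsP.
  have sz' : size (rcons t' v) == (h (last r s)).+1 by rewrite size_rcons size_tuple.
  by exists (Tuple sz'); rewrite /= rcons_path pt' lt' az last_rcons eqxx.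
exists (fun v => if v == r then r else odflt v [pick w | adj v w && (h v == (h w).+1)]), h.
split; first by rewrite eqxx.
  apply/eqP; rewrite -leqn0; apply: hmin.
  by apply/existsP; exists [tuple]; rewrite /= eqxx.
move=> v vC vr; rewrite (negPf vr); case: pickP => [w /andP [-> /eqP ->]//|no].
by have [w] := next v vC vr; rewrite no.
Qed.

(* A tree of maximum total height is normal: hanging [x] under an
   incomparable neighbour that is at least as deep increases every height
   below [x]. *)
Lemma normal_tree_exists : exists p h, rooted_tree p h /\ normal_tree p.
Proof.
have [p0 [h0 t0]] := distance_tree_exists.
(* The total height is at most [#|G| * #|G|]; strong induction on the gap replaces the choice of a
   maximum. *)
pose pot (h : G -> nat) := \sum_(v in component) h v.
have [n] : exists n, n = #|G| * #|G| - pot h0 by eexists.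
elim/ltn_ind: n p0 h0 t0 => n IHn p h t def_n.
have pot_le (h' : G -> nat) p' : rooted_tree p' h' -> pot h' <= #|G| * #|G|.
  move=> t'; apply: (@leq_trans (\sum_(v in component) #|G|)).
    by apply: leq_sum => v vC; apply/ltnW/(height_bound t').
  by rewrite sum_nat_const leq_mul2r max_card orbT.
case: (boolP [forall x in component, forall y, adj x y ==> anc p x y || anc p y x]).
  move=> /forallP cmp; exists p, h; split=> // x y xC xy.
  by have /implyP/(_ xC)/forallP/(_ y)/implyP/(_ xy) := cmp x.
have wlog_le x y : x \in component -> adj x y -> ~~ (anc p x y || anc p y x) ->
    h x <= h y -> exists p h, rooted_tree p h /\ normal_tree p.
  move=> xC xy; rewrite negb_or => /andP [nxy nyx] hxy.
  have yC := component_adj xC xy.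
  have xr : x != r by apply: contraNneq nxy => ->; apply: anc_root yC; exact: t.
  (* Rehanging puts [x] one level below [y]. As [h x <= h y], the whole subtree below [x] moves down
     by a positive amount. *)
  pose p' v := if v == x then y else p v.
  pose h' v := if v \in sub p x then h v + ((h y).+1 - h x) else h v.
  have h'y : h' y = h y by rewrite /h' inE (negPf nxy) andbF.
  have t' : rooted_tree p' h'.
    split.
    - by rewrite /p' eq_sym (negPf xr) (tree_root t).
    - rewrite /h' inE (_ : anc p x r = false) ?andbF ?(height_root t) //.
      apply: contraNF xr => xr'; apply/eqP.
      exact: (anc_anti t component_root xr' (anc_root t xC)).
    - move=> v vC vr; rewrite /p'; case: (eqVneq v x) => [->|vx].
        rewrite h'y /h' mem_sub //; split=> //; lia.
      split; first exact: (adj_parent t vC vr).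
      have -> : h' (p v) = if v \in sub p x then h (p v) + ((h y).+1 - h x) else h (p v).
        rewrite /h' (subE _ _ vC) (subE _ _ (component_parent t vC)); congr (if _ then _ else _).
        apply/idP/idP => [/anc_trans->//|xv]; first exact: anc_parent.
        by apply: anc_neq_parent; rewrite // eq_sym.
      by rewrite /h' (height_parent t vC vr); case: ifP => // _; rewrite addSn.
  have lt_pot : pot h < pot h'.
    rewrite /pot (bigD1 x) //= [X in _ < X](bigD1 x) //=.
    rewrite -addSn leq_add //; first by rewrite /h' mem_sub //; lia.
    by apply: leq_sum => v _; rewrite /h'; case: ifP; lia.
  by apply: (IHn _ _ p' h' t' erefl); have := pot_le _ _ t'; lia.
rewrite negb_forall => /existsP [x]; rewrite negb_imply => /andP [xC].
rewrite negb_forall => /existsP [y]; rewrite negb_imply => /andP [xy nxy].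
case: (leqP (h x) (h y)) => [|/ltnW]; first exact: wlog_le xC xy nxy.
by apply: wlog_le; [exact: component_adj xy | rewrite adj_sym | rewrite orbC].
Qed.

End RootedTrees.

(** * Back edges in a cactus *)

Lemma next_traject (T : eqType) (f : T -> T) x n z :
    uniq (traject f x n.+1) -> z \in traject f x n.+1 ->
  next (traject f x n.+1) z = if z == iter n f x then x else f z.
Proof.
move=> Us /trajectP [i]; rewrite ltnS => le_in ->.
have nth_s k : k <= n -> iter k f x = nth x (traject f x n.+1) k.
  by move=> le_kn; rewrite nth_traject.
have index_s k : k <= n -> index (iter k f x) (traject f x n.+1) = k.
  by move=> le_kn; rewrite nth_s // index_uniq // size_traject.
rewrite next_nth; have -> : iter i f x \in traject f x n.+1.
  by apply/trajectP; exists i.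
have -> : (iter i f x == iter n f x) = (i == n).
  by apply/eqP/eqP => [e|->//]; rewrite -(index_s i) // e index_s.
rewrite index_s // trajectS /=; case: (eqVneq i n) => [->|ne_in].
  by rewrite nth_default // size_traject.
by rewrite (set_nth_default (f x)) ?size_traject ?nth_traject ?ltn_neqAle ?ne_in // -iterSr.
Qed.

Section BackEdges.
Variables (G : sgraph) (r : G) (p : G -> G) (h : G -> nat).
Hypothesis tree_ph : rooted_tree r p h.
Hypothesis cactusG : cactus G.
Implicit Types (x y v w a u : G).
Local Notation C := (component r).

Definition back a u := [&& adj a u, anc p a u & p u != a].

(** The tree edge from [v] to [p v] lies on the cycle closed by the back edge between [a] and
    [u]. *)
Definition covers v a u := [&& back a u, anc p v u, anc p a v & v != a].

Lemma back_neq_root a u : u \in C -> back a u -> u != r.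
Proof.
move=> uC /and3P [au anc_au pu]; apply: contraNneq pu => ur; subst u.
by rewrite (tree_root tree_ph) (anc_anti tree_ph uC anc_au (anc_root tree_ph (component_anc tree_ph anc_au uC))).
Qed.

Lemma back_neq a u : back a u -> a != u.
Proof. by case/and3P=> au _ _; apply: contraTneq au => ->; rewrite adj_irrefl. Qed.

Lemma covers_parent v a u : u \in C -> covers v a u -> p v != a -> covers (p v) a u.
Proof.
move=> uC /and4P [b vu av va] pva; apply/and4P; split=> //.
  exact: anc_trans (anc_parent p v) vu.
by apply: anc_neq_parent; rewrite // eq_sym.
Qed.

Lemma covers_self a u : back a u -> covers u a u.
Proof. by move=> b; rewrite /covers b anc_refl; case/and3P: (b) => _ -> _;
  rewrite eq_sym back_neq. Qed.

(** The tree path from [u] up to [a], which the back edge closes to a cycle. *)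
Definition back_cycle a u := traject p u (h u - h a).+1.

Lemma back_iter a u : u \in C -> anc p a u -> iter (h u - h a) p u = a.
Proof.
move=> uC /ancP [n <-]; rewrite (height_iter tree_ph) //.
case: (leqP n (h u)) => [le_n|/ltnW lt_n]; first by rewrite subKn.
have e : iter (h u) p u = r.
  apply: (height_eq0 tree_ph); first by apply: (component_anc tree_ph _ uC); apply: fconnect_iter.
  by rewrite (height_iter tree_ph) // subnn.
rewrite (eqP lt_n) subn0 -[in RHS](subnK lt_n) iterD e iter_fix //.
exact: tree_root tree_ph.
Qed.

(** A back edge avoids the parent of [u] and so spans at least two levels. Hence its cycle has at
    least three vertices, and heights distinguish it from tree edges. *)
Lemma back_height a u : u \in C -> back a u -> (h a).+1 < h u.
Proof.
move=> uC b; have /and3P [_ au pua] := b; have ur := back_neq_root uC b.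
rewrite (height_parent tree_ph uC ur) ltnS.
apply: (anc_height tree_ph (component_parent tree_ph uC)); last by rewrite eq_sym.
by apply: anc_neq_parent => //; apply: back_neq.
Qed.

Lemma mem_back_cycle a u v : u \in C -> anc p a u ->
  (v \in back_cycle a u) = anc p v u && anc p a v.
Proof.
move=> uC au; apply/trajectP/andP => [[i lt_i ->]|[vu av]].
  split; first exact: fconnect_iter.
  rewrite -(back_iter uC au); move: lt_i; rewrite ltnS => le_i.
  by rewrite -(subnK le_i) iterD; apply: fconnect_iter.
exists (h u - h v); last by rewrite back_iter.
rewrite ltnS leq_sub2l //; case: (eqVneq a v) => [->//|ne].
exact: ltnW (anc_height tree_ph (component_anc tree_ph vu uC) av ne).
Qed.

Lemma uniq_back_cycle a u : u \in C -> uniq (back_cycle a u).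
Proof.
move=> uC; apply: (@map_uniq _ _ h); rewrite /back_cycle.
suff -> : [seq h i | i <- traject p u (h u - h a).+1] = [seq h u - i | i <- iota 0 (h u - h a).+1].
  rewrite map_inj_in_uniq ?iota_uniq // => i j; rewrite !mem_iota; lia.
apply: (@eq_from_nth _ 0); first by rewrite !size_map size_traject size_iota.
move=> i; rewrite size_map size_traject => lt_i.
rewrite (nth_map u) ?size_traject // nth_traject // (nth_map 0) ?size_iota //.
by rewrite nth_iota // (height_iter tree_ph).
Qed.

Lemma back_cycleP a u : u \in C -> back a u -> is_cycle (back_cycle a u).
Proof.
move=> uC b; have /and3P [adj_au au _] := b.
apply/and3P; split.
- by rewrite size_traject; have := back_height uC b; lia.
- exact: uniq_back_cycle.
rewrite /back_cycle trajectS /= rcons_path last_traject back_iter // adj_au andbT.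
have path_up n x : x \in C -> n <= h x -> path (@adj G) x (traject p (p x) n).
  elim: n x => //= n IHn x xC lt_n.
  have xr : x != r by apply: contraTneq lt_n => ->; rewrite (height_root tree_ph).
  rewrite (adj_parent tree_ph xC xr) /=; apply: IHn; first exact: (component_parent tree_ph xC).
  by move: lt_n; rewrite (height_parent tree_ph xC xr).
by apply: path_up => //; apply: leq_subr.
Qed.

Lemma next_back_cycle a u v : u \in C -> back a u -> v \in back_cycle a u ->
  next (back_cycle a u) v = if v == a then u else p v.
Proof.
move=> uC b vs; have /and3P [_ au _] := b.
by rewrite next_traject ?uniq_back_cycle ?back_iter.
Qed.

Lemma set2_eq (x y z t : G) :
  [set x; y] = [set z; t] -> (x = z /\ y = t) \/ (x = t /\ y = z).
Proof.
move=> e; have : x \in [set z; t] by rewrite -e set21.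
have : y \in [set z; t] by rewrite -e set22.
have : z \in [set x; y] by rewrite e set21.
have : t \in [set x; y] by rewrite e set22.
rewrite !inE; do 4![case/orP=> /eqP ?]; subst; auto.
Qed.

(** Both cycles contain the edge from [v] to [p v], so in a cactus they have the same edges. The
    edge between [a] and [u] then lies on the second cycle, and it can only be the closing edge
    there because tree edges span one level. *)
Lemma covers_uniq v a u a' u' : u \in C -> u' \in C ->
  covers v a u -> covers v a' u' -> a = a' /\ u = u'.
Proof.
move=> uC u'C /and4P [b vu av va] /and4P [b' vu' av' va'].
have /and3P [_ au pua] := b; have /and3P [_ au' pua'] := b'.
have vs : v \in back_cycle a u by rewrite mem_back_cycle // vu av.
have vs' : v \in back_cycle a' u' by rewrite mem_back_cycle // vu' av'.
have es : [set v; p v] \in cycle_edges (back_cycle a u).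
  by apply/imsetP; exists v => //; rewrite next_back_cycle // (negPf va).
have es' : [set v; p v] \in cycle_edges (back_cycle a' u').
  by apply/imsetP; exists v => //; rewrite next_back_cycle // (negPf va').
have eq_es : cycle_edges (back_cycle a u) = cycle_edges (back_cycle a' u').
  apply/eqP/contraT => /(cactusG (back_cycleP uC b) (back_cycleP u'C b')).
  by move/disjoint_setI0/setP/(_ [set v; p v]); rewrite !inE es es'.
have : [set a; u] \in cycle_edges (back_cycle a' u').
  rewrite -eq_es; apply/imsetP; exists a;
    last by rewrite next_back_cycle ?eqxx // mem_back_cycle // au anc_refl.
  by rewrite mem_back_cycle // au anc_refl.
case/imsetP=> z zs'; rewrite next_back_cycle //.
have := back_height uC b; have := back_height u'C b'.
case: eqVneq => [->|za'] lt' lt /set2_eq [[e1 e2]|[e1 e2]] //.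
- by move: lt lt'; rewrite e1 e2; clear; lia.
- suff le_ua : h u <= h a by move: lt; rewrite ltnNge (leq_trans le_ua (leqnSn _)).
  rewrite e2 -e1; case: (eqVneq a r) => [->|ar]; first by rewrite (tree_root tree_ph).
  by rewrite (height_parent tree_ph (component_anc tree_ph au uC) ar).
- by move: pua; rewrite e1 e2 eqxx.
Qed.

End BackEdges.

(** * Orientation with even out-degrees *)

Lemma odd_sum (T : finType) (A : {set T}) (F : T -> nat) :
  odd (\sum_(i in A) F i) = odd #|[set i in A | odd (F i)]|.
Proof.
rewrite -sum1_card big_mkcond [in RHS]big_mkcond /=.
apply: (big_ind2 (fun m n => odd m = odd n)) => // [m1 m2 n1 n2|i _].
  by rewrite !oddD => -> ->.
by rewrite inE; case: (i \in A) => //=; case: (boolP (odd (F i))) => // /negbTE.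
Qed.

Lemma odd_symdiff (T : finType) (A B : {set T}) :
  odd #|A| (+) odd #|B| = odd #|[set x | (x \in A) (+) (x \in B)]|.
Proof.
rewrite -!sum1_card big_mkcond [X in _ (+) odd X]big_mkcond [in RHS]big_mkcond /=.
rewrite -oddD -big_split /=.
apply: (big_ind2 (fun m n => odd m = odd n)) => // [m1 m2 n1 n2|i _].
  by rewrite !oddD => -> ->.
by rewrite inE; case: (i \in A); case: (i \in B).
Qed.

Section Orientation.
Variables (G : sgraph) (r : G) (p : G -> G) (h : G -> nat).
Hypothesis tree_ph : rooted_tree r p h.
Hypothesis cmp_p : normal_tree r p.
Implicit Types (x y v w a u c : G).
Local Notation C := (component r).

Definition down_deg x := #|[set y | adj x y && anc p x y]|.

(** The parity of the number of edges inside the subtree below [v], each edge being counted at its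
    upper end. *)
Definition up v := odd (\sum_(x in sub r p v) down_deg x).

(* Back edges point away from the root; the direction of the tree edge above
   [v] is the one that makes the out-degree of [v] even. *)
Definition darc x y :=
  adj x y && (if p y == x then ~~ up y else if p x == y then up x else anc p x y).

Definition out x := #|[set y | darc x y]|.

Definition children w := [set c in C | (c != r) && (p c == w)].

Lemma mem_children v : v \in C -> v != r -> v \in children (p v).
Proof. by move=> vC vr; rewrite inE vC vr eqxx. Qed.

Lemma childrenP c w : reflect [/\ c \in C, c != r & p c = w] (c \in children w).
Proof.
apply: (iffP idP) => [|[cC cr /eqP pc]]; first by rewrite inE => /and3P [? ? /eqP].
by rewrite inE cC cr.
Qed.

Lemma adj_neq x y : @adj G x y -> x != y.
Proof. by apply: contraTneq => ->; rewrite adj_irrefl. Qed.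

Lemma adj_child w v : v \in C -> adj w v -> p v = w -> v \in children w.
Proof.
move=> vC wv pv; apply/childrenP; split=> //.
by apply: contraTneq wv => vr; rewrite -pv vr (tree_root tree_ph) adj_irrefl.
Qed.

Lemma child_height c w : c \in children w -> h c = (h w).+1.
Proof. by case/childrenP=> cC cr <-; apply: (height_parent tree_ph). Qed.

Lemma parent_asym v : v \in C -> v != r -> p (p v) != v.
Proof.
move=> vC vr; apply/eqP => e; have := height_parent tree_ph vC vr.
case: (eqVneq (p v) r) => [pr|pr].
  by move=> _; move: vr; rewrite -e pr (tree_root tree_ph) eqxx.
by rewrite (height_parent tree_ph (component_parent tree_ph vC) pr) e; clear; lia.
Qed.

Lemma darc_adj x y : darc x y -> adj x y.
Proof. by case/andP. Qed.

Lemma darc_up c w : c \in children w -> darc c w = up c.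
Proof.
case/childrenP=> cC cr <-; rewrite /darc (adj_parent tree_ph cC cr) eqxx.
by rewrite (negPf (parent_asym cC cr)).
Qed.

Lemma darc_down c w : c \in children w -> darc w c = ~~ up c.
Proof.
by case/childrenP=> cC cr <-; rewrite /darc adj_sym (adj_parent tree_ph cC cr) eqxx.
Qed.

Lemma darc_back a u : u \in C -> back p a u -> darc a u.
Proof.
move=> uC b; have := back_height tree_ph uC b; case/and3P: b => au anc_au pu.
rewrite /darc au (negPf pu) anc_au; case: eqP => // pa.
have aC := component_anc tree_ph anc_au uC.
have -> := height_parent tree_ph aC; first by rewrite pa; clear; lia.
apply: contra_eqN pa => /eqP ar; rewrite ar (tree_root tree_ph) -ar.
by apply: contraTneq au => ->; rewrite adj_irrefl.
Qed.

Variant darc_spec x y : Prop :=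
  | ArcUp of x \in children y & up x
  | ArcDown of y \in children x & ~~ up y
  | ArcBack of back p x y.

Lemma darcP x y : x \in C -> darc x y -> darc_spec x y.
Proof.
move=> xC xy; have yC := component_adj xC (darc_adj xy); move: xy; rewrite /darc.
case/andP=> xy; case: eqP => [py|/eqP py]; first by apply: ArcDown; apply: adj_child.
case: eqP => [px|_ anc_xy]; last by apply: ArcBack; rewrite /back xy anc_xy.
by apply: ArcUp; apply: adj_child; rewrite 1?adj_sym.
Qed.

Lemma adjP x y : x \in C -> adj x y ->
  [|| x \in children y, y \in children x, back p x y | back p y x].
Proof.
move=> xC xy; have yC := component_adj xC xy.
case: (eqVneq (p y) x) => [py|py]; first by rewrite (adj_child yC) ?orbT.
case: (eqVneq (p x) y) => [px|px]; first by rewrite (adj_child xC) 1?adj_sym.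
by rewrite /back (adj_sym y) xy py px !andbT /= cmp_p ?orbT.
Qed.

Lemma darc_asym x y : x \in C -> adj x y -> darc y x = ~~ darc x y.
Proof.
move=> xC xy; have yC := component_adj xC xy.
have back_asym a u : a \in C -> u \in C -> back p a u -> darc u a = ~~ darc a u.
  move=> aC uC b; rewrite (darc_back uC b); apply/negbTE/negP => ua.
  have lt := back_height tree_ph uC b; have /and3P [_ _ /eqP pu] := b.
  case: (darcP uC ua) => [/childrenP [_ _] //|/child_height|/(back_height tree_ph aC)].
    by move: lt; clear; lia.
  by move: lt; clear; lia.
case/or4P: (adjP xC xy) => [c|c|b|b].
- by rewrite (darc_up c) (darc_down c).
- by rewrite (darc_up c) (darc_down c) negbK.
- exact: back_asym.
- by rewrite (back_asym y x) // negbK.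
Qed.

Lemma children_anc v x : v \in C -> x \in C -> x != v -> anc p v x ->
  exists2 c, c \in children v & anc p c x.
Proof.
move=> vC xC xv /ancP [n]; elim: n => [|n IHn] /= in x xC xv *.
  by move=> e; rewrite e eqxx in xv.
rewrite -iterS iterSr => e.
have xr : x != r.
  by apply: contraNneq xv => xr;
    rewrite -e xr (tree_root tree_ph) iter_fix // (tree_root tree_ph).
case: (eqVneq (p x) v) => [px|px].
  by exists x; rewrite ?anc_refl // -px mem_children.
have [c cv cx] := IHn (p x) (component_parent tree_ph xC) px e.
by exists c => //; apply: anc_trans cx (anc_parent p x).
Qed.

Lemma children_disj v c c' x : x \in C -> c \in children v -> c' \in children v ->
  anc p c x -> anc p c' x -> c = c'.
Proof.
move=> xC cv c'v cx c'x; have hc := child_height cv; have hc' := child_height c'v.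
have cC := component_anc tree_ph cx xC; have c'C := component_anc tree_ph c'x xC.
case: (eqVneq c c') => // ne; case/orP: (anc_total cx c'x) => an.
  by have := anc_height tree_ph c'C an ne; rewrite hc hc' ltnn.
by move: ne; rewrite eq_sym => /(anc_height tree_ph cC an); rewrite hc hc' ltnn.
Qed.

Lemma sum_sub v (F : G -> nat) : v \in C ->
  \sum_(x in sub r p v) F x = F v + \sum_(c in children v) \sum_(x in sub r p c) F x.
Proof.
move=> vC; rewrite (bigD1 v) /=; last exact: mem_sub.
congr (_ + _); rewrite (exchange_big_dep (fun x => (x \in sub r p v) && (x != v))) /=.
  apply: eq_bigr => x /andP [+ xv]; rewrite inE => /andP [xC vx].
  have [c cv cx] := children_anc vC xC xv vx.
  rewrite (big_pred1 c) // => c' /=; rewrite subE //; apply/andP/eqP => [[c'v c'x]|-> //].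
  exact: children_disj xC c'v cv c'x cx.
move=> c x cv; rewrite inE => /andP [xC cx].
have hc := child_height cv; have /childrenP [cC cr pc] := cv.
rewrite subE // (anc_trans _ cx) -?pc ?anc_parent //=.
apply: contraTneq cx => -> /=; rewrite pc; apply/negP => /(anc_height tree_ph vC).
have ne : c != v by apply: contra_eqN hc => /eqP ->; clear; lia.
by move=> /(_ ne); rewrite hc; clear; lia.
Qed.

Lemma sub_root : sub r p r = C.
Proof. by apply/setP => x; rewrite inE; case xC: (x \in C); rewrite // (anc_root tree_ph). Qed.

(** Compared with the edges going down from [v], the arcs leaving [v] lose the tree edges to the
    children in [U] and gain the edge to the parent when [up v] holds. Since [up v] is the parity of
    [down_deg v] plus [#|U|], everything cancels except at the root. *)
Lemma odd_out v : v \in C ->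
  odd (out v) = (v == r) && odd (\sum_(x in C) down_deg x).
Proof.
move=> vC; pose U := [set c in children v | up c].
have odd_sub : odd (\sum_(x in sub r p v) down_deg x) = odd (down_deg v) (+) odd #|U|.
  by rewrite sum_sub // oddD odd_sum.
have diffE : [set x | (x \in [set y | darc v y]) (+) (x \in [set y | adj v y && anc p v y])]
    = U :|: (if (v != r) && up v then [set p v] else set0).
  apply/setP => y; rewrite !inE.
  have -> : (y \in (if (v != r) && up v then [set p v] else set0)) =
      [&& v != r, up v & y == p v].
    by case: (v == r); case: (up v); rewrite !inE.
  case vy: (adj v y); last first.
    rewrite /darc vy /=; apply/esym/negbTE; rewrite negb_or; apply/andP; split.
      apply/negP => /andP [/and3P [yC yr /eqP py] _].
      by move: vy; rewrite -py adj_sym (adj_parent tree_ph yC yr).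
    apply/negP => /and3P [vr _ /eqP yp]; move: vy.
    by rewrite yp (adj_parent tree_ph vC vr).
  have yC := component_adj vC vy.
  case/or4P: (adjP vC vy) => [c|c|b|b].
  - have /childrenP [_ vr pv] := c.
    rewrite (darc_up c) vr pv eqxx andbT /=.
    have hv := child_height c.
    have -> : anc p v y = false.
      apply/negP => vyA; have := anc_height tree_ph yC vyA (adj_neq vy).
      by rewrite hv; clear; lia.
    case: (eqVneq (p y) v) => [py|]; last by rewrite !andbF addbF.
    by move/negP: (parent_asym vC vr); rewrite pv py eqxx.
  - have hy := child_height c; have /childrenP [_ yr py] := c.
    rewrite (darc_down c) yC yr py eqxx /= -{1}py anc_parent addbT negbK.
    suff -> : (y == p v) = false by rewrite !andbF orbF.
    apply/eqP => yp; move: hy; rewrite yp; case: (eqVneq v r) => [->|vr].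
      by rewrite (tree_root tree_ph); clear; lia.
    by rewrite (height_parent tree_ph vC vr); clear; lia.
  - rewrite (darc_back yC b); have := back_height tree_ph yC b.
    have /and3P [_ -> /negPf ->] := b; rewrite !andbF /= => hy; apply/esym/negbTE.
    apply: contraTN hy => /and3P [vr _ /eqP ->].
    by rewrite (height_parent tree_ph vC vr) -leqNgt; clear; lia.
  - have hy := back_height tree_ph vC b; have yv : darc v y = false.
      by rewrite (darc_asym yC) ?(darc_back vC b) // adj_sym.
    have /and3P [_ yv_anc pv] := b.
    have -> : anc p v y = false.
      apply/negP => vy_anc; move: hy; rewrite (anc_anti tree_ph yC vy_anc yv_anc).
      by clear; lia.
    rewrite yv (eq_sym y (p v)) (negPf pv) !andbF orbF; apply/esym/negbTE.
    apply: contraTN hy => /andP [/and3P [_ yr /eqP <-] _].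
    by rewrite (height_parent tree_ph yC yr) -leqNgt; clear; lia.
have := odd_symdiff [set y | darc v y] [set y | adj v y && anc p v y].
rewrite diffE -/(out v) -/(down_deg v).
case: (eqVneq v r) => [vr|vr] /=.
  rewrite setU0 -sub_root -{2}vr odd_sub => <-.
  by rewrite addbCA addbb addbF.
have pvU : p v \notin U.
  by apply/negP; rewrite inE => /andP [/childrenP [_ _ /eqP]];
    rewrite (negPf (parent_asym vC vr)).
case: ifP => [upv|upv].
  rewrite setUC cardsU1 pvU oddD /= => e.
  have: up v by []. rewrite /up odd_sub; move: e.
  by case: (odd (out v)); case: (odd (down_deg v)); case: (odd #|U|).
rewrite setU0 => e; have : up v = false by []. rewrite /up odd_sub; move: e.
by case: (odd (out v)); case: (odd (down_deg v)); case: (odd #|U|).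
Qed.

End Orientation.

(** * Coloring from the root downwards *)

Lemma fresh_color (S : {set 'I_4}) : #|S| <= 3 -> exists c, c \notin S.
Proof.
move=> leS; suff /card_gt0P [c] : 0 < #|~: S| by rewrite inE; exists c.
by have := cardsC S; rewrite card_ord; move: leS; clear; lia.
Qed.

(* Colors for the in-neighbours [I] of a vertex of color [c0] among its children,
   given the set [A] of colors of its in-neighbours above; [v0] is the only child
   that lies on a cycle passing through that vertex to a higher one, whose color
   is [alpha]. *)
Lemma odd_assignment (T : finType) (I : {set T}) (v0 : T) (c0 alpha gamma : 'I_4)
    (A : {set 'I_4}) :
    (#|A| <= 1) || [&& alpha == c0, #|A| == 2 & gamma \in A] -> c0 \notin A ->
  exists f : T -> 'I_4,
    [/\ forall v, v \in I -> f v != c0, v0 \in I -> f v0 != alpha,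
        forall v, v \in I -> f v \in A -> #|A| = 2 /\ f v = gamma
      & forall c, let N := (c \in A) + #|[set v in I | f v == c]| in (N == 0) || odd N].
Proof.
move=> sizeA c0A.
have constE c d : #|[set v in I | d == c :> 'I_4]| = (c == d) * #|I|.
  case: (eqVneq c d) => _; first by rewrite mul1n; apply: eq_card => v; rewrite !inE andbT.
  by apply/eqP; rewrite cards_eq0; apply/eqP/setP => v; rewrite !inE andbF.
(* When [A] has two colors, [alpha] coincides with [c0]. *)
have leS : #|c0 |: (alpha |: A)| <= 3.
  case/orP: sizeA => [leA|/and3P [/eqP -> /eqP A2 _]].
    by rewrite !cardsU1; apply: leq_add (leq_b1 _) (leq_add (leq_b1 _) leA).
  by rewrite setUA setUid cardsU1 A2 c0A.
have [beta] := fresh_color leS; rewrite !inE !negb_or => /and3P [bc0 balpha bA].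
(* An odd number of children can share the new color [beta]. *)
case: (boolP (odd #|I|)) => oddI.
  exists (fun=> beta); split=> // [v _|c]; first by rewrite (negPf bA).
  rewrite constE /=; case: (eqVneq c beta) => [->|_]; first by rewrite (negPf bA) mul1n oddI orbT.
  by rewrite addn0; case: (c \in A).
(* An even number of children can join [gamma], which already occurs once above; the total stays
   odd. *)
case/orP: sizeA => [leA|/and3P [/eqP ealpha /eqP A2 gA]]; last first.
  have gc0 : gamma != c0 by apply: contraNneq c0A => <-.
  exists (fun=> gamma); split=> // [_|c]; first by rewrite ealpha.
  rewrite constE /=; case: (eqVneq c gamma) => [->|_]; first by rewrite gA mul1n /= oddI.
  by rewrite addn0; case: (c \in A).
(* A nonempty even set splits into one child of color [beta] and an odd rest of color [delta]. As
   [delta] may equal [alpha], the single child is [v0] whenever [v0] is in [I]. *)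
have [delta] : exists d, d \notin c0 |: (beta |: A).
  by apply: fresh_color; rewrite !cardsU1; apply: leq_add (leq_b1 _) (leq_add (leq_b1 _) leA).
rewrite !inE !negb_or => /and3P [dc0 dbeta dA].
case: (set_0Vmem I) => [I0|[i iI]].
  exists (fun=> beta); split=> // [v|c]; first by rewrite I0 inE.
  by rewrite constE I0 cards0 muln0 addn0; case: (c \in A).
pose v1 := if v0 \in I then v0 else i.
have v1I : v1 \in I by rewrite /v1; case: ifP.
exists (fun v => if v == v1 then beta else delta); split.
- by move=> v _; case: ifP.
- by move=> v0I; rewrite /v1 v0I eqxx.
- by move=> v _; case: ifP => _; rewrite ?(negPf bA) ?(negPf dA).
move=> c /=; case: (eqVneq c beta) => [->|cb].
  rewrite (negPf bA) (_ : [set v in I | _] = [set v1]) ?cards1 //.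
  apply/setP => v; rewrite !inE; case: (v =P v1) => [->|_]; first by rewrite v1I eqxx.
  by rewrite (negPf dbeta) andbF.
case: (eqVneq c delta) => [->|cd].
  rewrite (negPf dA) (_ : [set v in I | _] = I :\ v1); last first.
    apply/setP => v; rewrite !inE; case: (v == v1); rewrite ?eqxx ?andbT // eq_sym.
    by rewrite (negPf dbeta) andbF.
  by move: oddI; rewrite (cardsD1 v1 I) v1I add1n /= negbK => ->; rewrite orbT.
rewrite (_ : [set v in I | _] = set0) ?cards0 ?addn0; first by case: (c \in A).
by apply/setP => v; rewrite !inE; case: (v == v1); rewrite eq_sym ?(negPf cb) ?(negPf cd) andbF.
Qed.

Section LocallyIrregularColoring.
Variables (G : sgraph) (T : eqType) (col : G -> G -> T).

Definition color_deg x i := #|[set z | adj x z && (col x z == i)]|.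

(** Edge colorings are represented by functions on pairs of vertices. [S] will be a component or the
    whole graph, so that it is closed under adjacency. *)
Definition li_coloring (S : {set G}) : Prop :=
  (forall x y, x \in S -> adj x y -> col x y = col y x) /\
  (forall x y, x \in S -> adj x y -> color_deg x (col x y) != color_deg y (col x y)).

End LocallyIrregularColoring.

Section Coloring.
Variables (G : sgraph) (r : G) (p : G -> G) (h : G -> nat).
Hypothesis tree_ph : rooted_tree r p h.
Hypothesis cmp_p : normal_tree r p.
Hypothesis cactusG : cactus G.
Implicit Types (x y v w a u c : G) (g : G -> 'I_4).
Local Notation C := (component r).
Local Notation darc := (darc r p).
Local Notation up := (up r p).
Local Notation children := (children r p).
Local Notation back := (back p).
Local Notation covers := (covers p).

(* The children of the root that share its color.  It is nonempty only when the
   root has out-degree 1: two such children then raise the degree of the root in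
   its own color to 3. *)
Variable Sp : {set G}.
Hypothesis SpP : forall v, v \in Sp -> v \in children r /\ up v.
(** Otherwise [w] would receive the color of the root twice, along the back edge and from its
    parent. *)
Hypothesis Sp_safe : forall w, back r w -> p w \in Sp -> up w.

Definition in_color g w (c : 'I_4) := #|[set v in C | darc v w & g v == c]|.

(** The last condition makes the vertices of a cycle avoid the color of its upper end [a], so that
    the lower end does not receive this color from its parent as well. *)
Definition tree_proper g v :=
  [/\ v \in Sp -> g v = g r, v \notin Sp -> g v != g (p v)
    & v \notin Sp -> forall a u, u \in C -> covers v a u -> g v != g a].

(** The last condition serves the root, whose degree in its own color may be odd: its out-neighbours
    get degree 1 in that color. *)
Definition in_colors_odd g w :=
  [/\ forall c : 'I_4, c != g w -> (in_color g w c == 0) || odd (in_color g w c),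
      in_color g w (g w) = (w == r) * #|Sp|
    & darc r w -> in_color g w (g r) = 1].

Lemma back_parent_neq_root a u : u \in C -> back a u -> p u != r.
Proof.
move=> uC b; have /and3P [_ au pu] := b.
apply: contraNneq pu => pr; have := anc_neq_parent au (back_neq b).
rewrite pr => ar; rewrite (anc_anti tree_ph _ ar) //; first exact: component_root.
exact: (anc_root tree_ph (component_anc tree_ph au uC)).
Qed.

Section Step.
Variables (g : G -> 'I_4) (w : G).
Hypothesis wC : w \in C.
Hypothesis g_proper : forall v, v \in C -> v != r -> h v <= h w -> tree_proper g v.

(** The in-neighbours of [w] that are already colored: possibly its parent, and the upper end of a
    back edge at [w]. *)
Let Ab := [set v in C | darc v w & v \notin children w].
Let A := g @: Ab.

Lemma above_spec v : v \in Ab ->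
  [/\ v = p w, w != r, darc (p w) w & ~~ up w] \/ back v w.
Proof.
rewrite inE => /and3P [vC vw nc]; case: (darcP tree_ph vC vw) => [c|c nup|]; last by right.
  by rewrite c in nc.
by have /childrenP [_ wr pw] := c; left; rewrite pw.
Qed.

Lemma back_above_uniq b b' : back b w -> back b' w -> b = b'.
Proof.
by move=> /covers_self cb /covers_self cb'; case: (covers_uniq tree_ph cactusG wC wC cb cb').
Qed.

Lemma above_proper v : v \in Ab -> g w != g v.
Proof.
case/above_spec=> [[-> wr _ nup]|b].
  have [_ + _] := g_proper wC wr (leqnn _); apply.
  by apply: contra nup => /SpP [].
have wr := back_neq_root tree_ph wC b.
have [_ _ H] := g_proper wC wr (leqnn _); apply: (H _ v w wC (covers_self b)).
apply: contra (back_parent_neq_root wC b) => /SpP [/childrenP [_ _ ->]] _.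
exact: eqxx.
Qed.

(** The parent of [w] lies on the cycle closed by a back edge at [w], so its color differs from that
    of the upper end. If the parent is in [Sp], then [Sp_safe] makes the tree edge point up, and the
    parent is not in [Ab]. *)
Lemma above_inj : {in Ab &, injective g}.
Proof.
have key b : back b w -> darc (p w) w -> ~~ up w -> g (p w) != g b.
  move=> bw pw nup; have wr := back_neq_root tree_ph wC bw.
  have pr := back_parent_neq_root wC bw; have pC := component_parent tree_ph wC.
  have le_h : h (p w) <= h w by rewrite (height_parent tree_ph wC wr).
  have [_ _ H] := g_proper pC pr le_h; apply: (H _ b w wC).
    apply/negP => pSp; have [/childrenP [_ _ ppw] _] := SpP pSp.
    case/negP: nup; apply: Sp_safe => //; suff <- : b = r by [].
    have /and3P [_ anc_b pb] := bw.
    have := anc_neq_parent (anc_neq_parent anc_b (back_neq bw));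
      rewrite eq_sym pb ppw => /(_ isT) br.
    exact: (anc_anti tree_ph (component_root r) br (anc_root tree_ph (component_anc tree_ph anc_b wC))).
  by apply: (covers_parent wC (covers_self bw)); case/and3P: bw.
move=> v v' /above_spec [[-> wr pw nup]|b] /above_spec [[-> _ pw' nup']|b'] // e.
- by have := key _ b' pw nup; rewrite e eqxx.
- by have := key _ b pw' nup'; rewrite e eqxx.
- exact: back_above_uniq.
Qed.

Lemma card_above : #|A| = #|Ab|.
Proof. exact: card_in_imset above_inj. Qed.

Lemma above_le1 : (p w \notin Ab) \/ (forall b, ~~ back b w) -> #|Ab| <= 1.
Proof.
move=> H; apply/card_le1_eqP => v v' vA v'A.
case: (above_spec vA) (above_spec v'A) => [[ev _ _ _]|b] [[ev' _ _ _]|b'].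
- by rewrite ev ev'.
- by case: H => [|/(_ v')]; rewrite -?ev ?vA // b'.
- by case: H => [|/(_ v)]; rewrite -?ev' ?v'A // b.
- exact: back_above_uniq.
Qed.

Lemma above_le2 : #|Ab| <= 2.
Proof.
rewrite (cardsD1 (p w)); apply: (@leq_add _ _ 1 1); first exact: leq_b1.
apply/card_le1_eqP => v v'; rewrite !in_setD1 => /andP [vp vA] /andP [v'p v'A].
case: (above_spec vA) => [[e]|b]; first by rewrite e eqxx in vp.
case: (above_spec v'A) => [[e]|b']; first by rewrite e eqxx in v'p.
exact: back_above_uniq.
Qed.

Lemma in_color_split g' (c : 'I_4) : {in Ab, g' =1 g} ->
  in_color g' w c = (c \in A)
    + #|[set v in [set v in children w | up v && (v \notin Sp)] | g' v == c]|
    + (w == r) * #|[set v in Sp | g' v == c]|.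
Proof.
move=> eqg; rewrite /in_color.
have -> : (w == r) * #|[set v in Sp | g' v == c]|
    = #|[set v in children w | [&& v \in Sp, up v & g' v == c]]|.
  case: (eqVneq w r) => [->|wr]; rewrite ?mul1n.
    apply: eq_card => v; rewrite in_set [RHS]in_set.
    by case vS: (v \in Sp); rewrite ?andbF //=; have [-> ->] := SpP vS.
  apply/esym/eqP; rewrite cards_eq0; apply/eqP/setP => v; rewrite in_set in_set0.
  apply/negP => /and4P [/childrenP [_ _ pv] /SpP [/childrenP [_ _ pv'] _] _ _].
  by rewrite -pv pv' eqxx in wr.
have -> : (c \in A) = #|[set v in Ab | g' v == c]| :> nat.
  case: (boolP (c \in A)) => [/imsetP [v vA ->]|cA].
    rewrite (_ : [set v' in Ab | _] = [set v]) ?cards1 //.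
    apply/setP => v'; rewrite in_set in_set1; apply/andP/eqP => [[v'A /eqP]|->].
      by rewrite eqg // => /above_inj; apply.
    by rewrite vA eqg.
  apply/esym/eqP; rewrite cards_eq0; apply/eqP/setP => v; rewrite in_set in_set0.
  by apply: contraNF cA => /andP [vA /eqP <-]; rewrite eqg // imset_f.
rewrite -addnA [X in _ + X](_ : _ = #|[set v in children w | up v && (g' v == c)]|); last first.
  rewrite -[in RHS](cardsID Sp) addnC; congr (_ + _); apply: eq_card => v; rewrite !in_set.
    by case: (v \in Sp); rewrite ?andbF ?andbT //= -!andbA.
  by case: (v \in Sp); rewrite ?andbF ?andbT //= -!andbA.
rewrite -(cardsID (children w)) addnC; congr (_ + _); apply: eq_card => v.
  rewrite in_setD [v \in [set _ in C | _]]in_set [RHS]in_set [v \in Ab]in_set.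
  by case: (v \in C); case: (darc v w); case: (v \in children w); rewrite ?andbF ?andbT.
rewrite in_setI in_set [RHS]in_set.
case cv: (v \in children w); rewrite ?andbF ?andbT //= (darc_up tree_ph cv).
by have /childrenP [-> _ _] := cv.
Qed.

Lemma child_covers v a u : v \in children w -> u \in C -> covers v a u -> a != w ->
  covers w a u.
Proof.
move=> /childrenP [_ _ <-] uC cv aw.
by apply: (covers_parent uC cv); rewrite eq_sym.
Qed.

(** A back edge that covers a child of [w] and ends above [w] also covers [w], so by [covers_uniq]
    there is at most one such child. If there is one, no back edge has its lower end at [w], and
    only the parent can contribute to [A]. *)
Lemma special_child : exists v0 alpha,
  ((#|A| <= 1) || [&& alpha == g w, #|A| == 2 & g (p w) \in A]) /\
  (forall v a u, v \in children w -> u \in C -> covers v a u -> a != w ->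
    v = v0 /\ g a = alpha).
Proof.
pose S (t : G * G * G) :=
  [&& t.1.1 \in children w, t.2 \in C, covers t.1.1 t.1.2 t.2 & t.1.2 != w].
case: (pickP S) => [[[v0 a0] u0] /and4P [/= v0w u0C cov0 a0w]|noS]; last first.
  (* Without such a child [v0] is arbitrary, and [alpha] is taken to be a color that is forbidden
     anyway. *)
  exists w, (g w); split; last first.
    by move=> v a u vw uC cov aw; have := noS (v, a, u); rewrite /S /= vw uC cov aw.
  rewrite eqxx /= card_above; have := above_le2; rewrite leq_eqVlt.
  case/orP=> [/eqP A2|]; last by rewrite ltnS => ->.
  rewrite A2 /=; apply: contraT => gpA.
  have pwA : p w \notin Ab by apply: contra gpA => /(imset_f g).
  by have := above_le1 (or_introl pwA); rewrite A2.
have cov0w := child_covers v0w u0C cov0 a0w.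
exists v0, (g a0); split.
  apply/orP; left; rewrite card_above; apply: above_le1; right=> b; apply/negP => bw.
  have [_ e] := covers_uniq tree_ph cactusG u0C wC cov0w (covers_self bw).
  have /and4P [_ v0u0 _ _] := cov0.
  have := anc_height tree_ph u0C v0u0; rewrite e (child_height tree_ph v0w).
  have -> : v0 != w by apply: contraTneq v0w => ->; apply/negP => /(child_height tree_ph);
    clear; lia.
  by move=> /(_ isT); clear; lia.
move=> v a u vw uC cov aw; have covw := child_covers vw uC cov aw.
have [ea eu] := covers_uniq tree_ph cactusG uC u0C covw cov0w; subst a u; split=> //.
have /and4P [_ vu _ _] := cov; have /and4P [_ v0u _ _] := cov0.
exact: (children_disj tree_ph uC vw v0w vu v0u).
Qed.

(** Children in [I] are colored by [odd_assignment], those in [Sp] like the root, and the others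
    only need to avoid [g w] and [alpha]. Quantifying over the extensions [g'] allows the choices
    made for all vertices of one level to be combined. *)
Lemma coloring_step : exists f : G -> 'I_4, forall g',
  (forall v, v \in C -> h v <= h w -> g' v = g v) ->
  {in children w, g' =1 f} ->
  in_colors_odd g' w /\ (forall v, v \in children w -> tree_proper g' v).
Proof.
have [v0 [alpha [sizeA special]]] := special_child.
have gwA : g w \notin A.
  by apply/imsetP => -[v vA e]; have := above_proper vA; rewrite e eqxx.
pose I := [set v in children w | up v && (v \notin Sp)].
have [f1 [f1w f1v0 f1A f1odd]] := odd_assignment I v0 sizeA gwA.
have [b] : exists b, b \notin [set g w; alpha].
  by apply: fresh_color; rewrite cards2; case: (_ != _).
rewrite !inE negb_or => /andP [bw balpha].
exists (fun v => if v \in Sp then g r else if up v then f1 v else b) => g' eqg eqf.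
have rC := component_root r.
have gr : g' r = g r by apply: eqg; rewrite // (height_root tree_ph).
have gw : g' w = g w by apply: eqg.
have Ab_above v : v \in Ab -> h v <= h w.
  case/above_spec=> [[-> wr _ _]|bvw]; first by rewrite (height_parent tree_ph wC wr).
  by apply: ltnW; apply: leq_trans (back_height tree_ph wC bvw).
have eqgA : {in Ab, g' =1 g}.
  by move=> v vA; apply: eqg; [by move: vA; rewrite inE => /andP [] | exact: Ab_above].
have eqI (c : 'I_4) : [set v in I | g' v == c] = [set v in I | f1 v == c].
  apply/setP => v; rewrite in_set [RHS]in_set; case vI: (v \in I) => //=.
  move: vI; rewrite in_set => /and3P [vw upv vS].
  by rewrite eqf // (negPf vS) upv.
have eqSp (c : 'I_4) : (w == r) * #|[set v in Sp | g' v == c]| = (w == r) * ((c == g r) * #|Sp|).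
  case: (eqVneq w r) => [wr|//]; rewrite !mul1n.
  have eqv v : v \in Sp -> g' v = g r.
    by move=> vS; rewrite eqf ?vS // wr; case: (SpP vS).
  case: (eqVneq c (g r)) => [->|ne]; rewrite ?mul1n ?mul0n.
    by apply: eq_card => v; rewrite in_set; case vS: (v \in Sp); rewrite //= eqv ?eqxx.
  apply/eqP; rewrite cards_eq0; apply/eqP/setP => v; rewrite in_set in_set0.
  by apply/negP => /andP [/eqv -> /eqP e]; rewrite e eqxx in ne.
have splitE (c : 'I_4) := in_color_split c eqgA; split.
  split=> [c cw||rw].
  - rewrite splitE eqI eqSp; case: (eqVneq w r) => [wr|_]; last by rewrite mul0n addn0;
    apply: f1odd.
    rewrite mul1n (_ : c == g r = false) ?mul0n ?addn0; first exact: f1odd.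
    by move: cw; rewrite wr gr => /negPf.
  - rewrite splitE eqI eqSp gw (negPf gwA) add0n.
    rewrite (_ : [set v in I | _] = set0) ?cards0 ?add0n.
      by case: (eqVneq w r) => [->|_]; rewrite ?eqxx ?mul1n.
    by apply/setP => v; rewrite in_set in_set0; apply/negP => /andP [/f1w/negPf ->].
  have rAb : r \in Ab.
    by rewrite in_set rC rw /=; apply/negP => /childrenP [_]; rewrite eqxx.
  have wr : w != r by apply: contraTneq (darc_adj rw) => ->; rewrite adj_irrefl.
  have grA : g r \in A by apply: imset_f.
  rewrite splitE eqI eqSp gr grA (negPf wr) mul0n addn0.
  rewrite (_ : [set v in I | _] = set0) ?cards0 //.
  apply/setP => v; rewrite in_set in_set0; apply/negP => /andP [vI /eqP fv].
  (* A child with the color of the root would force two colors in [A] and [p w = r]. But then no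
     back edge has its lower end at [w], so [A] has at most one color. *)
  have fvA : f1 v \in A by rewrite fv.
  have [A2 fg] := f1A v vI fvA.
  have pwAb : p w \in Ab.
    by apply: contraT => pwA; have := above_le1 (or_introl pwA); rewrite -card_above A2.
  have pr : p w = r by apply: above_inj => //; rewrite -fg fv.
  have := above_le1; rewrite -card_above A2 => H; have : 1 < 1; last by [].
  apply: H; right=> b'; apply/negP => bb; have := back_parent_neq_root wC bb.
  by rewrite pr eqxx.
move=> v vw; have /childrenP [vC vr pv] := vw; split.
- by move=> vS; rewrite eqf // vS gr.
- move=> vS; rewrite eqf // (negPf vS) pv gw; case: ifP => // upv.
  by apply: f1w; rewrite in_set vw upv vS.
move=> vS a u uC cov; have /and4P [_ _ av va] := cov.
have aw : anc p a w by rewrite -pv; apply: anc_neq_parent; rewrite // eq_sym.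
have -> : g' a = g a.
  apply: eqg; first exact: (component_anc tree_ph aw wC).
  by case: (eqVneq a w) => [-> //|ne]; apply: ltnW; apply: (anc_height tree_ph).
rewrite eqf // (negPf vS).
have fw : (if up v then f1 v else b) != g w.
  by case: ifP => // upv; apply: f1w; rewrite in_set vw upv vS.
case: (eqVneq a w) => [-> //|ne].
have [ev ->] := special v a u vw uC cov ne.
by case: ifP => // upv; rewrite ev; apply: f1v0; rewrite -ev in_set vw upv vS.
Qed.

End Step.
Lemma darc_height x w : x \in C -> w \in C -> darc x w -> h x <= (h w).+1.
Proof.
move=> xC wC xw;
  case: (darcP tree_ph xC xw) => [/(child_height tree_ph) -> //|/(child_height tree_ph) ->|].
  by clear; lia.
by move/(back_height tree_ph wC); clear; lia.
Qed.

Lemma tree_proper_eq g g' v : v \in C -> v != r ->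
  (forall x, x \in C -> h x <= h v -> g' x = g x) ->
  tree_proper g v -> tree_proper g' v.
Proof.
move=> vC vr eqg [gr gp ga].
have er : g' r = g r by apply: eqg; rewrite ?component_root // (height_root tree_ph).
have ep : g' (p v) = g (p v).
  by apply: eqg; [exact: (component_parent tree_ph vC)|rewrite (height_parent tree_ph vC vr)].
split; rewrite ?er ?ep eqg // => vS a u uC cov; rewrite eqg; first exact: ga uC cov.
  by have /and4P [_ _ av _] := cov; exact: (component_anc tree_ph av vC).
by have /and4P [_ _ av va] := cov; apply: ltnW; apply: (anc_height tree_ph) => //; rewrite eq_sym.
Qed.

Lemma in_colors_odd_eq g g' w : w \in C ->
  (forall x, x \in C -> h x <= (h w).+1 -> g' x = g x) ->
  in_colors_odd g w -> in_colors_odd g' w.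
Proof.
move=> wC eqg.
have ec (c : 'I_4) : in_color g' w c = in_color g w c.
  apply: eq_card => x; rewrite in_set [RHS]in_set; case xC: (x \in C) => //=.
  by case xw: (darc x w) => //=; rewrite eqg // darc_height.
have er : g' r = g r by apply: eqg; rewrite ?component_root // (height_root tree_ph).
by rewrite /in_colors_odd er eqg // => -[H1 H2 H3]; split=> [c||]; rewrite ec //; apply: H1.
Qed.

(** In-neighbours lie at most one level below, so the colors received by [w] are settled once level
    [h w + 1] is colored. *)
Lemma coloring_upto n : exists g,
  (forall v, v \in C -> v != r -> h v <= n -> tree_proper g v) /\
  (forall w, w \in C -> h w < n -> in_colors_odd g w).
Proof.
elim: n => [|n [g [gP gN]]].
  exists (fun=> ord0); split=> // v vC vr; rewrite leqn0 => /eqP /(height_eq0 tree_ph vC) e.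
  by rewrite e eqxx in vr.
have [w|F FP] := @fin_all_exists G (fun=> G -> 'I_4) (fun w f => w \in C -> h w = n ->
    forall g' : G -> 'I_4, (forall v, v \in C -> h v <= h w -> g' v = g v) ->
    {in children w, g' =1 f} ->
    in_colors_odd g' w /\ (forall v, v \in children w -> tree_proper g' v)).
  case wC: (w \in C); last by exists g.
  case: (eqVneq (h w) n) => [hw|ne]; last by exists g => _ e; rewrite e eqxx in ne.
  have [|f fP] := coloring_step (g := g) wC.
    by move=> v vC vr; rewrite hw; apply: gP.
  by exists f => _ _; apply: fP.
(* Each vertex of the new level takes the color chosen for it at its parent. *)
pose g' v := if (v \in C) && (h v == n.+1) then F (p v) v else g v.
have eqg v : v \in C -> h v <= n -> g' v = g v.
  by move=> vC hv; rewrite /g' vC; case: eqP hv => //= ->; rewrite ltnn.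
have step w : w \in C -> h w = n -> in_colors_odd g' w /\
    (forall v, v \in children w -> tree_proper g' v).
  move=> wC hw; apply: FP => // [v vC|v vw]; first by rewrite hw; apply: eqg.
  have hv := child_height tree_ph vw; have /childrenP [vC _ pv] := vw.
  by rewrite /g' vC hv hw eqxx pv.
exists g'; split=> [v vC vr|w wC].
  rewrite leq_eqVlt => /orP [/eqP hv|]; last first.
    rewrite ltnS => hv; apply: (tree_proper_eq vC vr _ (gP v vC vr hv)) => x xC hx.
    by apply: eqg => //; apply: leq_trans hv.
  have [|_] := step (p v) (component_parent tree_ph vC); last by apply; apply: mem_children.
  by move: hv; rewrite (height_parent tree_ph vC vr) => -[].
rewrite ltnS leq_eqVlt => /orP [/eqP hw|hw]; first by case: (step w wC hw).
apply: (in_colors_odd_eq wC _ (gN w wC hw)) => x xC hx.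
by apply: eqg => //; apply: leq_trans hw.
Qed.

Definition arc_color g x y := if darc x y then g x else g y.

Lemma arc_color_sym g x y : x \in C -> adj x y -> arc_color g x y = arc_color g y x.
Proof.
by move=> xC xy; rewrite /arc_color (darc_asym tree_ph cmp_p xC xy); case: (darc x y).
Qed.

Lemma color_degreeE g x (c : 'I_4) : x \in C ->
  color_deg (arc_color g) x c = (g x == c) * out r p x + in_color g x c.
Proof.
move=> xC; rewrite /color_deg -(cardsID [set y | darc x y]); congr (_ + _).
  case: (eqVneq (g x) c) => [<-|gx]; rewrite ?mul1n ?mul0n.
    apply: eq_card => y; rewrite !in_set /arc_color.
    by case xy: (darc x y); rewrite ?andbF ?andbT // (darc_adj xy) eqxx.
  apply/eqP; rewrite cards_eq0; apply/eqP/setP => y; rewrite !in_set /arc_color.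
  by case xy: (darc x y); rewrite ?andbF ?andbT // (negPf gx) andbF.
apply: eq_card => y; rewrite !in_set /arc_color.
case xy: (adj x y) => /=; last first.
  rewrite andbF (_ : darc y x = false) ?andbF //.
  by apply: contraFF xy => /darc_adj; rewrite adj_sym.
rewrite (component_adj xC xy) (darc_asym tree_ph cmp_p xC xy) /=.
by case: (darc x y).
Qed.

(** In the color of an arc, a tail other than the root has even degree, its out-degree, and the head
    has odd degree. This includes arcs from [Sp] into the root, where the degree is
    [out r p r + #|Sp|]. For arcs leaving the root, this number is even or at least 3, whereas the
    head has degree 1. *)
Lemma tree_coloring :
    (~~ odd (out r p r)) && (#|Sp| == 0)
      || [&& odd (out r p r), ~~ odd #|Sp| & 3 <= out r p r + #|Sp|] ->
  exists col : G -> G -> 'I_4, li_coloring col C.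
Proof.
move=> rootP; have [g [gP gN]] := coloring_upto #|G|.
exists (arc_color g); split=> [x y|]; first exact: arc_color_sym.
have N w : w \in C -> in_colors_odd g w.
  by move=> wC; apply: gN => //; apply: (height_bound tree_ph).
have key x y : x \in C -> darc x y ->
    color_deg (arc_color g) x (g x) != color_deg (arc_color g) y (g x).
  move=> xC xy; have yC := component_adj xC (darc_adj xy).
  rewrite !color_degreeE // eqxx mul1n.
  have [_ Nx _] := N x xC; have [Ny1 Ny2 Ny3] := N y yC; rewrite Nx.
  have pos : 0 < in_color g y (g x).
    by apply/card_gt0P; exists x; rewrite inE xC xy eqxx.
  have odd_x : x != r -> odd (out r p x) = false.
    by move=> xr; rewrite (odd_out tree_ph cmp_p xC) (negPf xr).
  case: (eqVneq y r) => [yr|yr].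
    have xr : x != r by apply: contraTneq (darc_adj xy) => ->; rewrite yr adj_irrefl.
    rewrite (negPf xr) mul0n addn0; apply: contraFneq (odd_x xr) => ->.
    case: (eqVneq (g y) (g x)) => [e|ne].
      have NySp : in_color g y (g x) = #|Sp| by rewrite -e Ny2 yr eqxx mul1n.
      rewrite NySp mul1n yr oddD; move: pos; rewrite NySp;
        case/orP: rootP => [/andP [_ /eqP ->] //|].
      by case/and3P=> -> /negPf ->.
    rewrite eq_sym in ne; rewrite mul0n add0n.
    by case/orP: (Ny1 (g x) ne) => [/eqP N0|//]; rewrite N0 in pos.
  have gxy : g x != g y.
    by apply: contraTneq pos => ->; rewrite Ny2 (negPf yr).
  rewrite (eq_sym (g y)) (negPf gxy) mul0n add0n.
  case: (eqVneq x r) => [xr|xr]; last first.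
    rewrite mul0n addn0; apply: contraFneq (odd_x xr) => ->.
    by case/orP: (Ny1 (g x) gxy) => [/eqP N0|//]; rewrite N0 in pos.
  subst x; rewrite (Ny3 xy) /= mul1n.
  case/orP: rootP => [/andP [ev /eqP ->]|/and3P [_ _]].
    by rewrite addn0; apply: contraNneq ev => ->.
  by apply: contraTneq => ->.
move=> x y xC xy; have yC := component_adj xC xy.
have yx := darc_asym tree_ph cmp_p xC xy.
rewrite [arc_color g x y]/arc_color; case xya: (darc x y); first exact: key.
by rewrite eq_sym; apply: key; rewrite // yx xya.
Qed.

End Coloring.

(** * Choosing the root *)

Section Sides.
Variable G : sgraph.
Implicit Types (x y z a b c : G) (K : {set G}).

Definition degree_sum K := \sum_(x in K) #|[set y in K | adj x y]|.

(** Half of the degree sum is the number of edges inside [K]. *)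
Definition odd_edges K := odd (degree_sum K)./2.

Lemma sum_card_in K (P : rel G) :
  \sum_(x in K) #|[set y in K | P x y]| = \sum_(x in K) \sum_(y in K) P x y.
Proof.
apply: eq_bigr => x _; rewrite -sum1_card big_mkcond [RHS]big_mkcond.
by apply: eq_bigr => y _; rewrite inE; case: (y \in K); case: (P x y).
Qed.

Lemma degree_sum_orient K (R : rel G) :
    (forall x y, x \in K -> y \in K -> adj x y -> R y x = ~~ R x y) ->
  degree_sum K = (\sum_(x in K) #|[set y in K | adj x y && R x y]|).*2.
Proof.
move=> asymR; rewrite -addnn /degree_sum !sum_card_in [X in _ = _ + X]exchange_big /=.
rewrite -big_split /=; apply: eq_bigr => x xK; rewrite -big_split /=.
apply: eq_bigr => y yK; rewrite (adj_sym y); case xy: (adj x y) => //=.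
by rewrite (asymR x y) //; case: (R x y).
Qed.

(** [R] orients the edges inside [K], so its out-degrees count each of them once. It is applied to
    ancestry and to [tail]. *)
Lemma odd_edges_orient K (R : rel G) :
    (forall x y, x \in K -> y \in K -> adj x y -> R y x = ~~ R x y) ->
  odd_edges K = odd (\sum_(x in K) #|[set y in K | adj x y && R x y]|).
Proof. by move=> /degree_sum_orient; rewrite /odd_edges => ->; rewrite doubleK. Qed.

Definition adj_minus a : rel G := [rel y z | [&& adj y z, y != a & z != a]].

(** For [x != a] this is the component of [x] after deletion of the vertex [a]. *)
Definition side a x : {set G} := [set y | connect (adj_minus a) x y].

(** Disjointness means that a side is attached to the triangle only at [s]. The connecting edge
    between [s] and [x] is not counted in the side. *)
Definition bad_triangle a b c : Prop :=
  [/\ adj a b, adj b c, adj a c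
    & forall s x, s \in [set a; b; c] -> x \notin [set a; b; c] -> adj s x ->
        odd_edges (side s x) /\ [disjoint side s x & [set a; b; c]]].

End Sides.

Section BadRoot.
Variables (G : sgraph) (r : G) (p : G -> G) (h : G -> nat).
Hypothesis tree_ph : rooted_tree r p h.
Hypothesis cmp_p : normal_tree r p.
Hypothesis cactusG : cactus G.
Implicit Types (x y v w a u c : G).
Local Notation C := (component r).
Local Notation darc := (darc r p).
Local Notation up := (up r p).
Local Notation children := (children r p).
Local Notation back := (back p).
Local Notation covers := (covers p).
Local Notation out := (out r p).

Lemma odd_edges_sub v : v \in C -> odd_edges (sub r p v) = up v.
Proof.
move=> vC; rewrite (odd_edges_orient (R := anc p)) => [|x y].
  congr (odd _); apply: eq_bigr => x; rewrite inE => /andP [xC vx].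
  apply: eq_card => y; rewrite !inE; case xy: (adj x y); rewrite ?andbF //=.
  rewrite (component_adj xC xy) /=; case xya: (anc p x y); rewrite ?andbF // andbT.
  exact: anc_trans vx xya.
rewrite !inE => /andP [xC _] /andP [yC _] xy.
have := cmp_p xC xy; case xya: (anc p x y) => //= _; apply/negP => yxa.
by have := adj_neq xy; rewrite (anc_anti tree_ph yC xya yxa) eqxx.
Qed.

Lemma odd_edges_component : odd_edges C = odd (out r).
Proof.
rewrite -(sub_root tree_ph) odd_edges_sub ?component_root //.
by rewrite (odd_out tree_ph cmp_p (component_root r)) eqxx /= /up (sub_root tree_ph).
Qed.

(** Deleting [a] cuts off the subtree below [x] unless a back edge leads from it past [a], which the
    hypothesis on [covers] excludes. *)
Lemma side_sub a x : x \in children a -> a \in C ->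
    (forall b w, w \in C -> covers x b w -> b = a) ->
  side a x = sub r p x.
Proof.
move=> xa aC covx; have hx := child_height tree_ph xa; have /childrenP [xC xr px] := xa.
have sub_neq y : y \in C -> anc p x y -> y != a.
  move=> yC xy; apply: contraTneq xy => ->; apply/negP => xanc.
  have ne : x != a by apply: contra_eqN hx => /eqP ->; clear; lia.
  by have := anc_height tree_ph aC xanc ne; rewrite hx; clear; lia.
have step y z : y \in sub r p x -> adj_minus a y z -> z \in sub r p x.
  rewrite inE => /andP [yC xy] /and3P [yz ya za]; have zC := component_adj yC yz.
  rewrite subE //; case/or4P: (adjP tree_ph cmp_p yC yz) => [|||].
  - case/childrenP=> _ yr py; case: (eqVneq x y) => [e|ne].
      by move: za; rewrite -py -e px eqxx.
    by rewrite -py; apply: anc_neq_parent.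
  - by case/childrenP=> _ _ pz; apply: anc_trans xy _; rewrite -pz anc_parent.
  - by case/and3P=> _ yz_anc _; apply: anc_trans xy yz_anc.
  move=> b; have /and3P [_ zy _] := b; case/orP: (anc_total xy zy) => // zx.
  case: (eqVneq z x) => [->|ne]; first exact: anc_refl.
  case/eqP: za; apply: (covx z y yC); apply/and4P; split=> //.
  by rewrite eq_sym.
have closed s y : y \in sub r p x -> path (adj_minus a) y s -> last y s \in sub r p x.
  by elim: s y => //= z s IHs y yx /andP [/(step y z yx) zx]; apply: IHs.
apply/setP => y; rewrite in_set; apply/idP/idP => [/connectP [s ps ->]|].
  by apply: closed; rewrite ?mem_sub.
rewrite inE => /andP [+ /ancP [n]]; elim: n y => [|n IHn] y yC; first by move=> /= ->.
rewrite iterSr => e; have pyC := component_parent tree_ph yC.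
case: (eqVneq y r) => [yr|yr]; first by apply: IHn => //; rewrite -[RHS]e yr (tree_root tree_ph).
apply: connect_trans (IHn _ pyC e) (connect1 _).
have py_sub : anc p x (p y) by apply/ancP; exists n.
rewrite /adj_minus /= adj_sym (adj_parent tree_ph yC yr) (sub_neq _ pyC py_sub) (sub_neq _ yC) //.
exact: anc_trans py_sub (anc_parent p y).
Qed.

(** With out-degree at least 3, [Sp] can be empty; with out-degree 1, two safe children form [Sp].
    An unsafe child is the parent of an out-neighbour of the root, so out-degree 1 allows at most
    one; fewer than two safe children then leave exactly degree 3. *)
Lemma root_coloring_or_bad : odd_edges C -> 3 <= deg r ->
  (exists col : G -> G -> 'I_4, li_coloring col C) \/
  (deg r = 3 /\ exists v u, [/\ out r = 1, v \in children r, up v, u \in children v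
    & ~~ up u && back r u]).
Proof.
rewrite odd_edges_component => odd_r deg3.
pose I := [set c in children r | up c].
have rC := component_root r.
have deg_r : deg r = out r + #|I|.
  rewrite /deg -(cardsID [set y | darc r y]); congr (_ + _); apply: eq_card => x.
    by rewrite !in_set; case rx: (darc r x); rewrite ?andbF // (darc_adj rx).
  rewrite in_setD !in_set; case rx: (adj r x); last first.
    rewrite andbF; apply/esym/negbTE/negP => /andP [/and3P [xC xr /eqP px] _].
    by move: rx; rewrite -{1}px adj_sym (adj_parent tree_ph xC xr).
  have xC := component_adj rC rx; rewrite andbT -(darc_asym tree_ph cmp_p rC rx).
  have nb : ~~ back x r by apply/negP => /(back_neq_root tree_ph rC); rewrite eqxx.
  apply/idP/idP => [/(darcP tree_ph xC) [||]|].
  - by rewrite in_set => -> ->.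
  - by case/childrenP=> _; rewrite eqxx.
  - by rewrite (negPf nb).
  by case/andP=> xr upx; rewrite (darc_up tree_ph) // in_set.
pose unsafe c := [exists w, [&& w \in C, back r w, p w == c & ~~ up w]].
have color (Sp : {set G}) : Sp \subset [set c in I | ~~ unsafe c] -> ~~ odd #|Sp| ->
  3 <= out r + #|Sp| ->
    exists col : G -> G -> 'I_4, li_coloring col C.
  move=> /subsetP sSp evSp le3; apply: (tree_coloring tree_ph cmp_p cactusG (Sp := Sp)).
  - by move=> v /sSp; rewrite inE => /andP []; rewrite inE => /andP [].
  - move=> w b /sSp; rewrite inE => /andP [_]; rewrite negb_exists => /forallP /(_ w).
    by rewrite (component_adj rC) ?b ?eqxx ?negbK //; case/and3P: b.
  by rewrite odd_r evSp le3 orbT.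
case: (leqP 3 (out r)) => [le3|lt3].
  by left; apply: (color set0); rewrite ?sub0set ?cards0 ?addn0.
have out1 : out r = 1 by move: odd_r lt3; case: (out r) => [|[|[|]]].
case: (leqP 2 #|[set c in I | ~~ unsafe c]|) => [/card_gt1P [c [c' [cS c'S ne]]]|safe1].
  left; apply: (color [set c; c']); rewrite ?cards2 ?ne ?out1 //.
  by apply/subsetP => x; rewrite in_set2 => /orP [] /eqP ->.
right; rewrite out1 in deg_r.
have unsafe1 : #|[set c in I | unsafe c]| <= 1.
  apply/card_le1_eqP => c c'; rewrite in_set [c' \in _]in_set.
  case/andP=> _ /existsP [w /and4P [wC b /eqP <- _]].
  case/andP=> _ /existsP [w' /and4P [w'C b' /eqP <- _]].
  congr (p _); move: (out1) => /eqP /cards1P [w0] outE.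
  have := darc_back tree_ph wC b; have := darc_back tree_ph w'C b'.
  have outP x : darc r x -> x = w0.
    by move=> rx; apply/set1P; rewrite -outE in_set.
  by move=> /outP -> /outP ->.
have cardI : #|[set c in I | unsafe c]| + #|[set c in I | ~~ unsafe c]| = #|I|.
  rewrite -(cardsID [set c | unsafe c] I); congr (_ + _); apply: eq_card => c.
    by rewrite !in_set.
  by rewrite in_setD !in_set andbC.
split.
  by move: deg3; rewrite deg_r; move: unsafe1 safe1; rewrite -cardI; clear; lia.
have /card_gt0P [v] : 0 < #|[set c in I | unsafe c]|.
  by move: deg3; rewrite deg_r; move: unsafe1 safe1; rewrite -cardI; clear; lia.
rewrite in_set => /andP []; rewrite in_set => /andP [vr upv].
case/existsP=> u /and4P [uC b /eqP pu nup]; exists v, u; split=> //; last by rewrite nup b.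
by rewrite -pu; apply: mem_children; rewrite // (back_neq_root tree_ph uC b).
Qed.

(** All other edges at the triangle point into it: the only arc leaving [r] goes to [u], and a
    further arc would give [v] out-degree 3 or [u] out-degree 1, both odd. So they come from
    children with [up], whose subtrees have an odd number of edges. *)
Lemma bad_root_triangle v u : (forall x, x \in C -> deg x <= 3) -> deg r = 3 ->
    out r = 1 -> v \in children r -> up v -> u \in children v -> ~~ up u -> back r u ->
  bad_triangle r v u.
Proof.
move=> deg_le3 deg_r out1 vr upv uv nup b; have rC := component_root r.
have /childrenP [vC vnr pv] := vr; have /childrenP [uC unr pu] := uv.
have hv := child_height tree_ph vr; have hu := child_height tree_ph uv.
have rv : adj r v by rewrite adj_sym -{1}pv; apply: (adj_parent tree_ph).
have vu : adj v u by rewrite adj_sym -{1}pu; apply: (adj_parent tree_ph).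
have ru : adj r u by case/and3P: b.
have hr := height_root tree_ph; rewrite hr in hv; rewrite hv in hu.
have d_ru := darc_back tree_ph uC b.
have d_vu : darc v u by rewrite (darc_down tree_ph uv).
have d_vr : darc v r by rewrite (darc_up tree_ph vr).
have evenout x : x \in C -> x != r -> ~~ odd (out x).
  by move=> xC xr; rewrite (odd_out tree_ph cmp_p xC) (negPf xr).
have goal s x : x \notin [set r; v; u] -> x \in children s -> s \in C -> up x ->
    (forall b w, w \in C -> covers x b w -> b = s) ->
    (forall t, t \in [set r; v; u] -> ~~ anc p x t) ->
    odd_edges (side s x) /\ [disjoint side s x & [set r; v; u]].
  move=> xT xs sC upx covx xanc; rewrite side_sub //; have /childrenP [xC _ _] := xs.
  split; first by rewrite odd_edges_sub.
  by apply/pred0P => t /=; apply/negP => /andP []; rewrite inE => /andP [_ xt] /xanc /negP.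
split=> // s x; rewrite !inE -!orbA => /or3P [] /eqP -> {s};
  rewrite !negb_or => /and3P [xr xv xu] adj_x;
  have xC : x \in C by apply: component_adj adj_x.
- have nd : ~~ darc r x.
    apply/negP => d_rx; move/eqP: out1 => /cards1P [w0 outE].
    have eu : u = w0 by apply/set1P; rewrite -outE in_set.
    by have /set1P ex : x \in [set w0]; [rewrite -outE in_set | rewrite ex eu eqxx in xu].
  have : darc x r by rewrite (darc_asym tree_ph cmp_p rC adj_x).
  case/(darcP tree_ph xC) => [xr_child upx|/childrenP [_]|/(back_neq_root tree_ph rC)];
    rewrite ?eqxx //.
  have /childrenP [_ _ px] := xr_child.
  have nxv : ~~ anc p x v.
    apply/negP => xanc; case/eqP: xv.
    exact: (children_disj tree_ph vC xr_child vr xanc (anc_refl p v)).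
  apply: goal => //; first by rewrite !inE !negb_or xr xv xu.
    move=> a w wC /and4P [_ _ ax xa]; rewrite eq_sym in xa.
    have := anc_neq_parent ax xa; rewrite px => ar.
    exact: (anc_anti tree_ph rC ar (anc_root tree_ph (component_anc tree_ph ax xC))).
  move=> t; rewrite !inE -orbA => /or3P [] /eqP -> //.
    apply/negP => /(anc_anti tree_ph rC)/(_ (anc_root tree_ph xC)) e.
    by rewrite e eqxx in xr.
  by apply: contra nxv => /anc_neq_parent; rewrite pu; apply.
- have nd : ~~ darc v x.
    apply/negP => d_vx; have := evenout v vC vnr.
    suff -> : out v = 3 by [].
    apply/eqP; rewrite eqn_leq; apply/andP; split.
      by apply: leq_trans (deg_le3 v vC); apply: subset_leq_card; apply/subsetP => y;
        rewrite !in_set => /darc_adj.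
    have <- : #|[set r; u; x]| = 3.
      by rewrite setUC cardsU1 !inE negb_or xr xu cards2 (eq_sym r) unr.
    by apply: subset_leq_card; apply/subsetP => y; rewrite !inE -orbA => /or3P [] /eqP ->.
  have : darc x v by rewrite (darc_asym tree_ph cmp_p vC adj_x).
  case/(darcP tree_ph xC) => [x_v upx|/childrenP [_ _ e]|].
  + have nxu : ~~ anc p x u.
      apply/negP => xanc; case/eqP: xu.
      exact: (children_disj tree_ph uC x_v uv xanc (anc_refl p u)).
    have hx := child_height tree_ph x_v; apply: goal => //;
      first by rewrite !inE !negb_or xr xv xu.
      move=> a w wC cov; apply: contraTeq isT => ne.
      have covv : covers v a w by have /childrenP [_ _ <-] := x_v;
        apply: (covers_parent wC cov); have /childrenP [_ _ ->] := x_v; rewrite eq_sym.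
      have covu : covers v r u by rewrite -pu; apply: (covers_parent uC (covers_self b));
        case/and3P: b.
      have [_ ew] := covers_uniq tree_ph cactusG wC uC covv covu.
      by case/negP: nxu; rewrite -ew; case/and4P: cov.
    move=> t; rewrite !inE -orbA => /or3P [] /eqP -> //; apply/negP => /(anc_height tree_ph _).
      by move/(_ rC xr); rewrite hr hx.
    by move/(_ vC xv); rewrite hx ltnNge leqW.
  + by rewrite -e pv eqxx in xr.
  case/and3P=> _ xanc _; have := anc_neq_parent xanc xv; rewrite pv => /(anc_anti tree_ph rC).
  by move/(_ (anc_root tree_ph xC)) => e; rewrite e eqxx in xr.
have nd : ~~ darc u x.
  apply/negP => d_ux; have := evenout u uC unr.
  suff -> : out u = 1 by [].
  apply/eqP; rewrite eqn_leq; apply/andP; split; last by apply/card_gt0P; exists x;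
    rewrite in_set.
  have : #|[set y | darc u y] :|: [set r; v]| <= 3.
    apply: leq_trans (deg_le3 u uC); apply: subset_leq_card; apply/subsetP => y; rewrite !inE.
    by case/or3P=> [/darc_adj //|/eqP ->|/eqP ->]; rewrite adj_sym.
  rewrite cardsU (_ : _ :&: _ = set0) ?cards0 ?subn0 ?cards2 ?(eq_sym r) ?vnr.
    by rewrite addn2 !ltnS.
  apply/setP => y; rewrite !inE; apply/negP => /andP [d /orP [] /eqP e]; move: d; rewrite e.
    by rewrite (darc_asym tree_ph cmp_p rC ru) d_ru.
  by rewrite (darc_asym tree_ph cmp_p vC vu) d_vu.
have : darc x u by rewrite (darc_asym tree_ph cmp_p uC adj_x).
case/(darcP tree_ph xC) => [x_u upx|/childrenP [_ _ e]|bx].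
- have hx := child_height tree_ph x_u; rewrite hu in hx.
  apply: goal => //; first by rewrite !inE !negb_or xr xv xu.
    move=> a w wC cov; apply: contraTeq isT => ne.
    have covu : covers u a w by have /childrenP [_ _ <-] := x_u; apply: (covers_parent wC cov);
      have /childrenP [_ _ ->] := x_u; rewrite eq_sym.
    have [_ ew] := covers_uniq tree_ph cactusG wC uC covu (covers_self b).
    have /and4P [_ xw _ _] := cov; rewrite ew in xw.
    by have := anc_height tree_ph uC xw xu; rewrite hx hu.
  move=> t; rewrite !inE -orbA => /or3P [] /eqP -> //; apply/negP => /(anc_height tree_ph _).
  + by move/(_ rC xr); rewrite hr.
  + by move/(_ vC xv); rewrite hv hx.
  + by move/(_ uC xu); rewrite hu hx.
- by rewrite -e pu eqxx in xv.
have [e _] := covers_uniq tree_ph cactusG uC uC (covers_self bx) (covers_self b).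
by rewrite e eqxx in xr.
Qed.

End BadRoot.

(** * Components without a suitable root *)

Section SideLemmas.
Variable G : sgraph.
Implicit Types (x y z a b c s t : G).

Lemma bad_triangle_rot a b c : bad_triangle a b c -> bad_triangle b c a.
Proof.
have e : [set b; c; a] = [set a; b; c] by apply/setP => x; rewrite !inE -!orbA orbA orbC.
by case=> ab bc ac H; split; rewrite ?e //; rewrite adj_sym.
Qed.

Lemma bad_triangle_swap a b c : bad_triangle a b c -> bad_triangle a c b.
Proof.
have e : [set a; c; b] = [set a; b; c] by apply/setP => x; rewrite !inE -!orbA; congr (_ || _);
  rewrite orbC.
by case=> ab bc ac H; split; rewrite ?e //; rewrite adj_sym.
Qed.

Lemma connect_minus_sym a : connect_sym (adj_minus a).
Proof. by apply: sym_connect_sym => y z; rewrite /adj_minus /= adj_sym (andbC (y != a)). Qed.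

Lemma side_self s x : x \in side s x.
Proof. by rewrite inE connect0. Qed.

Lemma side_step s x y z : y \in side s x -> adj y z -> y != s -> z != s -> z \in side s x.
Proof.
rewrite !inE => xy yz ys zs; apply: connect_trans xy (connect1 _).
by rewrite /adj_minus /= yz ys.
Qed.

Lemma side_ind s x (P : G -> Prop) : P x ->
    (forall y z, y \in side s x -> z \in side s x -> P y -> adj y z -> P z) ->
  forall z, z \in side s x -> P z.
Proof.
move=> Px step z; rewrite inE => /connectP [l].
elim/last_ind: l z => [|l y IHl] z /=; first by move=> _ ->.
rewrite rcons_path last_rcons => /andP [pl ly] ->.
have lx : last x l \in side s x by rewrite inE; apply/connectP; exists l.
have yx : y \in side s x.
  by move: lx; rewrite !inE => xl; apply: connect_trans xl (connect1 ly).
by apply: (step _ _ lx yx (IHl _ pl erefl)); case/and3P: ly.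
Qed.

Lemma side_avoid s t x z : t \notin side s x -> z \in side s x -> z \in side t x.
Proof.
move=> ts; apply: (side_ind (P := fun z => z \in side t x)); first exact: side_self.
move=> {}z y zs ys zt zy; apply: (side_step zt zy); first by apply: contraNneq ts => <-.
by apply: contraNneq ts => <-.
Qed.

(** From a common vertex, [y] can be reached inside [side b y], hence without meeting [a]. So
    [side a x] would contain [y] and then its neighbour [b], a vertex of the triangle. *)
Lemma bad_sides_disjoint a b c x y : bad_triangle a b c ->
    adj a x -> x \notin [set a; b; c] -> adj b y -> y \notin [set a; b; c] ->
  [disjoint side a x & side b y].
Proof.
move=> bad ax xT by_ yT; have [ab _ _ H] := bad.
have aT : a \in [set a; b; c] by rewrite !inE eqxx.
have bT : b \in [set a; b; c] by rewrite !inE eqxx orbT.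
have [_ /pred0P dx] := H a x aT xT ax; have [_ /pred0P dy] := H b y bT yT by_.
apply/pred0P => z /=; apply/negP => /andP [zx zy].
have a_y : a \notin side b y by apply/negP => ay; have := dy a; rewrite /= ay aT.
have := side_avoid a_y zy; rewrite inE connect_minus_sym => zy'.
have yx : y \in side a x by move: zx; rewrite !inE => xz; apply: connect_trans xz zy'.
have := dx b; rewrite /= bT (side_step yx) //; first by rewrite adj_sym.
  by apply: contraNneq yT => ->.
by apply: contraTneq ab => ->; rewrite adj_irrefl.
Qed.

End SideLemmas.

Section Obstruction.
Variables (G : sgraph) (r : G) (T : eqType) (col : G -> G -> T).
Local Notation C := (component r).
Hypothesis col_li : li_coloring col C.
Hypothesis deg_le3 : forall x, x \in C -> deg x <= 3.
Hypothesis all_bad : forall x, x \in C -> deg x = 3 -> exists b c, bad_triangle x b c.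
Implicit Types (x y z a b c s t : G).

Definition edge_deg y z := color_deg col y (col y z).
Local Notation d := edge_deg.

Lemma col_sym y z : y \in C -> adj y z -> col z y = col y z.
Proof. by case: col_li => H _ yC yz; rewrite (H y z). Qed.

Lemma edge_deg_neq y z : y \in C -> adj y z -> d y z != d z y.
Proof. by move=> yC yz; rewrite /d (col_sym yC yz); case: col_li => _; apply. Qed.

Lemma edge_deg_gt0 y z : adj y z -> 0 < d y z.
Proof. by move=> yz; apply/card_gt0P; exists z; rewrite inE yz eqxx. Qed.

Lemma color_deg_le3 y i : y \in C -> color_deg col y i <= 3.
Proof.
move=> yC; apply: leq_trans (deg_le3 yC); apply: subset_leq_card; apply/subsetP => z.
by rewrite !inE => /andP [].
Qed.

Lemma color_deg2_le3 y i j : y \in C -> i != j -> color_deg col y i + color_deg col y j <= 3.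
Proof.
move=> yC ij; apply: leq_trans (deg_le3 yC); rewrite -cardsUI.
rewrite [X in _ + X](_ : _ = 0) ?addn0.
  by apply: subset_leq_card; apply/subsetP => z; rewrite !inE => /orP [] /andP [].
apply/eqP; rewrite cards_eq0; apply/eqP/setP => z; rewrite !inE.
by apply/negP => /andP [/andP [_ /eqP ->]]; rewrite (negPf ij) andbF.
Qed.

(** At a vertex of degree at most 3 only one color can have degree 2, so the set has zero or two
    elements. *)
Lemma even_pairs y : y \in C -> ~~ odd #|[set z | adj y z && (d y z == 2)]|.
Proof.
move=> yC; case: (set_0Vmem [set z | adj y z && (d y z == 2)]) => [->|[z0]].
  by rewrite cards0.
rewrite inE => /andP [yz0 /eqP dz0]; suff -> : [set z | adj y z && (d y z == 2)] =
    [set z | adj y z && (col y z == col y z0)] by rewrite -/(color_deg _ _ _) -/(d y z0) dz0.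
apply/setP => z; rewrite !inE; case yz: (adj y z) => //=.
apply/eqP/eqP => [dz|cz]; last by rewrite /d cz.
apply/eqP/contraT => ne; have := color_deg2_le3 yC ne.
by rewrite -/(d y z) -/(d y z0) dz dz0.
Qed.

Lemma three_neighbors y a b c : y \in C -> uniq [:: a; b; c] ->
  adj y a -> adj y b -> adj y c -> [set z | adj y z] = [set a; b; c].
Proof.
move=> yC U ya yb yc; apply/esym/eqP; rewrite eqEcard; apply/andP; split.
  by apply/subsetP => z; rewrite !inE -orbA => /or3P [] /eqP ->.
apply: leq_trans (deg_le3 yC) _; rewrite setUC cardsU1 cards2 !inE.
by move: U => /= /and3P []; rewrite !inE negb_or => /andP [-> ac] /negPf bc _;
  rewrite (eq_sym c) (negPf ac) eq_sym bc.
Qed.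

(** The edge from [b] to [x] leaves the triangle and has color degree 2 at its inner end [b]. By
    local irregularity it cannot have color degree 2 at [x] as well, which is what [outer_edge_in]
    would give. *)
Definition escape y b c x : Prop :=
  [/\ bad_triangle y b c, x \notin [set y; b; c], adj b x & d b x = 2] /\
  [/\ col b x = col b c, d b y = 1 & forall w, adj y w -> d y w = 3].

(* In a triangle [y, b, c] with the three edges at [y] of one color, the edge
   [b - c] has another color, so one of its ends, say [b], has degree 2 in it. *)
Lemma mono_triangle y z : y \in C -> adj y z -> d y z = 3 -> deg y = 3 /\
  forall b c, bad_triangle y b c -> exists b' c' x, escape y b' c' x.
Proof.
move=> yC yz d3; have deg3 : deg y = 3.
  apply/eqP; rewrite eqn_leq deg_le3 //= -d3; apply: subset_leq_card.
  by apply/subsetP => w; rewrite !inE => /andP [].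
have mono w : adj y w -> col y w = col y z.
  move=> yw; have : w \in [set w | adj y w && (col y w == col y z)].
    rewrite (_ : [set w | _ && _] = [set w | adj y w]) ?inE //.
    apply/eqP; rewrite eqEcard -/(deg y) deg3 -/(color_deg _ _ _) -/(d y z) d3 andbT.
    by apply/subsetP => u; rewrite !inE => /andP [].
  by rewrite inE => /andP [_ /eqP].
split=> // b c bad; have [yb bc yc _] := bad.
have bC := component_adj yC yb; have cC := component_adj yC yc.
have dy w : adj y w -> d y w = 3 by move=> yw; rewrite /d mono.
have le_d w : adj y w -> d w y <= 2.
  move=> yw; have wC := component_adj yC yw.
  have := color_deg_le3 (col w y) wC; rewrite leq_eqVlt => /orP [/eqP e|//].
  by have := edge_deg_neq yC yw; rewrite dy // /d e.
have ge2 u w v : u \in C -> adj u w -> adj u v -> w != v -> col u w = col u v -> 1 < d u w.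
  move=> uC uw uv wv e; apply/card_gt1P; exists w, v; rewrite !inE uw uv e eqxx.
  by [].
(* If the edge between [b] and [c] had the common color too, both its ends would have degree exactly
   2 in it. *)
have ne_bc : col b c != col y z.
  apply/eqP => e; have := edge_deg_neq bC bc.
  have by_ : adj b y by rewrite adj_sym.
  have cb : adj c b by rewrite adj_sym.
  have cy : adj c y by rewrite adj_sym.
  have cby : col b y = col b c by rewrite e (col_sym yC yb) mono.
  have ccy : col c y = col c b by rewrite (col_sym bC bc) e (col_sym yC yc) mono.
  have y_c : c != y by apply: contraTneq yc => ->; rewrite adj_irrefl.
  have y_b : b != y by apply: contraTneq yb => ->; rewrite adj_irrefl.
  have db := ge2 b c y bC bc by_ y_c (esym cby).
  have dc := ge2 c b y cC cb cy y_b (esym ccy).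
  have := le_d b yb; have := le_d c yc; rewrite /d cby ccy -/(d b c) -/(d c b).
  by move: db dc; clear; case: (d b c) (d c b) => [|[|[|?]]] [|[|[|?]]].
have main b' c' : bad_triangle y b' c' -> col b' c' != col y z -> d b' c' = 2 ->
  exists b' c' x, escape y b' c' x.
  move=> bad' ne' d2; have [yb' bc' yc' _] := bad'; have b'C := component_adj yC yb'.
  have /card_gt1P [x [x' [xc x'c xx']]] : 1 < #|[set z | adj b' z && (col b' z == col b' c')]|.
    by rewrite -/(color_deg _ _ _) -/(d b' c') d2.
  have [w [b'w cw wc']] : exists w, [/\ adj b' w, col b' w = col b' c' & w != c'].
    move: xc x'c; rewrite !inE => /andP [bx /eqP cx] /andP [bx' /eqP cx'].
    by case: (eqVneq x c') => [e|ne]; [exists x'; rewrite bx' cx' -e eq_sym | exists x;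
      rewrite bx cx].
  exists b', c', w; split; split=> //.
  - rewrite !inE !negb_or wc' andbT; apply/andP; split.
      by apply: contraNneq ne' => e; rewrite -cw e (col_sym yC yb') mono.
    by apply: contraTneq b'w => ->; rewrite adj_irrefl.
  - by rewrite /d cw.
  apply/eqP; rewrite eqn_leq edge_deg_gt0 1?adj_sym // andbT.
  have cb'y : col b' y = col y z by rewrite (col_sym yC yb') mono.
  have := color_deg2_le3 b'C (_ : col b' y != col b' c').
  by rewrite cb'y eq_sym ne' -/(d b' c') d2 -cb'y -/(d b' y) => /(_ isT); clear; lia.
have cb : adj c b by rewrite adj_sym.
have le2 u w v : u \in C -> adj u w -> adj u v -> col u w != col u v -> d u w <= 2.
  move=> uC uw uv ne; have := color_deg2_le3 uC ne; have := edge_deg_gt0 uv.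
  by rewrite /d; clear; lia.
have db : d b c <= 2.
  by apply: (le2 b c y bC bc); rewrite 1?adj_sym // (col_sym yC yb) mono.
have dc : d c b <= 2.
  by apply: (le2 c b y cC cb); rewrite 1?adj_sym // (col_sym bC bc) (col_sym yC yc) mono.
have [e|e] : d b c = 2 \/ d c b = 2.
  have := edge_deg_neq bC bc; have := edge_deg_gt0 bc; have := edge_deg_gt0 cb.
  move: db dc; clear; case: (d b c) (d c b) => [|[|[|?]]] [|[|[|?]]] //; by [left|right].
- exact: (main b c).
- by apply: (main c b (bad_triangle_swap bad)) => //; rewrite (col_sym bC bc).
Qed.

(* Color degrees are 1, 2 or 3 and differ along an edge, so every edge has exactly
   one tail. *)
Definition tail y z := (d y z == 2) || (d y z == 3) && (d z y == 1).

Lemma tail_asym y z : y \in C -> adj y z -> tail z y = ~~ tail y z.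
Proof.
move=> yC yz; have zC := component_adj yC yz; have zy : adj z y by rewrite adj_sym.
have := edge_deg_neq yC yz; have := edge_deg_gt0 yz; have := edge_deg_gt0 zy.
have := color_deg_le3 (col y z) yC; have := color_deg_le3 (col z y) zC.
rewrite -/(d y z) -/(d z y) /tail; clear.
by case: (d y z) (d z y) => [|[|[|[|?]]]] [|[|[|[|?]]]].
Qed.

(** If the conclusion failed, every vertex of the side would be the tail of an even number of edges
    inside it, although the side has an odd number of edges. The induction handles the vertices
    whose three edges share a color. *)
Lemma outer_edge_in n a b c x : #|side a x| <= n -> a \in C -> bad_triangle a b c ->
  x \notin [set a; b; c] -> adj a x -> d x a = 2.
Proof.
elim: n a b c x => [|n IHn] a b c x.
  by rewrite leqn0 cards_eq0 => /eqP s0; have := side_self a x; rewrite s0 inE.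
move=> le_n aC bad xT ax; apply/eqP/contraT => dxa.
pose T0 := [set a; b; c]; pose K := side a x.
have [ab bc ac ext] := bad; have aT : a \in T0 by rewrite !inE eqxx.
have [oddK disK] := ext a x aT xT ax.
have KT z : z \in K -> z \notin T0 by move=> zK; rewrite (disjointFr disK zK).
have aK : a \notin K by apply: contraL aT => /KT.
have Kstep y z : y \in K -> adj y z -> z != a -> z \in K.
  move=> yK yz; apply: side_step yz _ => //; by apply: contraNneq aK => <-.
have KC y : y \in K -> y \in C.
  apply: (side_ind (P := fun y => y \in C)) => [|y1 z1 _ _ y1C]; last exact: component_adj.
  exact: component_adj aC ax.
have neq_xbc : uniq [:: b; c; x].
  move: xT; rewrite !inE !negb_or -andbA => /and3P [_ xb xc].
  by rewrite /= !inE negb_or adj_neq //= eq_sym xb eq_sym xc.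
have Na := three_neighbors aC neq_xbc ab ac ax.
have bcT t : t \in [set b; c] -> t \in T0 by rewrite !inE -orbA => ->; rewrite orbT.
have aKx y : y \in K -> adj y a -> y = x.
  move=> yK ya; have : y \in [set z | adj a z] by rewrite inE adj_sym.
  by rewrite Na in_setU in_set1 => /orP [/bcT yT|/eqP //]; have := KT y yK; rewrite yT.
suff : ~~ odd_edges K by rewrite oddK.
rewrite (odd_edges_orient (R := tail)) => [|y z yK _]; last by apply: tail_asym; apply: KC.
rewrite odd_sum (_ : [set y in K | _] = set0) ?cards0 //.
apply/setP => y; rewrite in_set in_set0; apply/negP => /andP [yK]; apply/negP.
have yC := KC y yK.
(* Without an edge of degree 3, [y] is the tail of exactly its edges of degree 2. None of these ends
   in [a], because only [x] is adjacent to [a] in [K] and [d x a] is not 2. *)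
case: (boolP [exists z, adj y z && (d y z == 3)]) => [|nomono]; last first.
  rewrite (_ : [set z in K | _] = [set z | adj y z && (d y z == 2)]) ?even_pairs //.
  apply/setP => z; rewrite in_set [RHS]in_set; case yz: (adj y z); rewrite ?andbF //=.
  move: nomono; rewrite negb_exists => /forallP /(_ z); rewrite yz /= => d3.
  rewrite /tail (negPf d3) orbF /=; case: (boolP (d y z == 2)) => d2; rewrite ?andbF // andbT.
  apply: (Kstep y) => //; apply: contraTneq d2 => za; move: yz; rewrite za => ya.
  by rewrite (aKx y yK ya).
case/existsP=> z /andP [yz /eqP d3]; have [deg3 tri] := mono_triangle yC yz d3.
have [b0 [c0 bad0]] := all_bad yC deg3;
  have [b1 [c1 [x1 [[bad1 x1T bx1 dbx1] [cbx1 dby mono]]]]] := tri _ _ bad0.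
have [yb1 bc1 yc1 ext1] := bad1; pose T1 := [set y; b1; c1].
(* Otherwise [a] would have two distinct neighbours in [K], but [x] is the only one. *)
have aT1 : a \notin T1.
  apply/negP; rewrite !inE -orbA => /or3P [] /eqP e.
  - by rewrite e yK in aK.
  - have yx : y = x by apply: aKx; rewrite // e.
    have c1K : c1 \in K by apply: (Kstep y) => //; rewrite e eq_sym adj_neq.
    have : c1 \in [set z | adj a z] by rewrite inE e.
    rewrite Na in_setU in_set1 => /orP [c1T|/eqP c1x]; first by have := KT c1 c1K; rewrite bcT.
    by have := adj_neq yc1; rewrite yx c1x eqxx.
  have yx : y = x by apply: aKx; rewrite // e.
  have b1K : b1 \in K by apply: (Kstep y) => //; rewrite e adj_neq.
  have : b1 \in [set z | adj a z] by rewrite inE e adj_sym.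
  rewrite Na in_setU in_set1 => /orP [b1T|/eqP b1x]; first by have := KT b1 b1K; rewrite bcT.
  by have := adj_neq yb1; rewrite yx b1x eqxx.
have b1K : b1 \in K by apply: (Kstep y) => //; apply: contraNneq aT1 => <-;
  rewrite !inE eqxx orbT.
have c1K : c1 \in K by apply: (Kstep y) => //; apply: contraNneq aT1 => <-;
  rewrite !inE eqxx orbT.
(* A side at [s] that misses [a] stays inside [K] and omits [s], so it is smaller and the induction
   hypothesis applies. *)
have away s t u w : bad_triangle s t u -> s \in K -> w \notin [set s; t; u] -> adj s w ->
    a \notin side s w -> d w s = 2.
  move=> bads sK wT sw a_w; have [_ _ _ exts] := bads.
  have sT : s \in [set s; t; u] by rewrite !inE eqxx.
  have [_ dis] := exts s w sT wT sw.
  apply: (IHn s t u w) => //; last exact: KC.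
  have wK : w \in K.
    by apply: (Kstep s) => //; apply: contraNneq a_w => <-; apply: side_self.
  rewrite -ltnS; apply: leq_trans le_n; apply: proper_card; apply/properP; split.
    apply/subsetP => z1; apply: (side_ind (P := fun z => z \in K)) => // y2 z2 _ z2s y2K yz2.
    by apply: (Kstep y2) => //; apply: contraNneq a_w => <-.
  by exists s => //; apply/negP => ss; have := disjointFr dis ss; rewrite sT.
(* Otherwise the escaping edge would have degree 2 at both ends. Hence the other sides of this
   triangle, being disjoint from [side b1 x1], miss [a]. *)
have a_side : a \in side b1 x1.
  apply: contraT => a_x1.
  have e : [set b1; c1; y] = T1 by apply/setP => t; rewrite !inE -!orbA orbA orbC.
  have := away b1 c1 y x1 (bad_triangle_rot bad1) b1K; rewrite e => /(_ x1T bx1 a_x1) d2.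
  by have := edge_deg_neq (KC _ b1K) bx1; rewrite dbx1 d2.
have other s t u w : bad_triangle s t u -> [set s; t; u] = T1 -> b1 = t -> adj s w ->
    w \notin T1 -> s \in K -> d w s = 2.
  move=> bads eT b1t sw wT sK; apply: (away s t u) => //; first by rewrite eT.
  have := bad_sides_disjoint bads sw; rewrite eT => /(_ x1 wT).
  by rewrite -b1t => /(_ bx1 x1T) dis; rewrite (disjointFl dis a_side).
(* If this degree were 2, the second edge would either go to [b1], giving the edges from [b1] to [y]
   and [x1] one color despite their degrees 1 and 2, or leave the triangle and have degree 2 at both
   ends. *)
have dc1 : d c1 y = 1.
  have c1y : adj c1 y by rewrite adj_sym.
  have cC := KC _ c1K; have bC := KC _ b1K.
  have := edge_deg_gt0 c1y; have := color_deg_le3 (col c1 y) cC.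
  have := edge_deg_neq yC yc1; rewrite mono // -/(d c1 y).
  case def_d: (d c1 y) => [|[|[|[|?]]]] // _ _ _; exfalso.
  have /card_gt1P [w [w' [wS w'S ww']]] : 1 < #|[set z | adj c1 z && (col c1 z == col c1 y)]|.
    by rewrite -/(color_deg _ _ _) -/(d c1 y) def_d.
  have [v [cv ecv vy]] : exists v, [/\ adj c1 v, col c1 v = col c1 y & v != y].
    move: wS w'S; rewrite !inE => /andP [cw /eqP ew] /andP [cw' /eqP ew'].
    by case: (eqVneq w y) => [e|ne]; [exists w'; rewrite cw' ew' -e eq_sym | exists w;
      rewrite cw ew].
  have vb : v != b1.
    apply/eqP => vb; suff e : col b1 y = col b1 x1.
      by move: dby; rewrite /d e -/(d b1 x1) dbx1.
    have e1 : col c1 y = col b1 c1 by rewrite -ecv vb (col_sym bC bc1).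
    rewrite cbx1 -e1 (col_sym yC yb1) (col_sym yC yc1).
    apply/eqP/contraT => ne; have := color_deg2_le3 yC ne.
    by rewrite -/(d y b1) -/(d y c1) !mono.
  have vT : v \notin T1.
    rewrite !inE !negb_or vy vb /=; apply: contraTneq cv => ->; by rewrite adj_irrefl.
  have e : [set c1; b1; y] = T1.
    by apply/setP => t; rewrite !inE; case: (t == y); case: (t == b1); case: (t == c1).
  have d2 := other c1 b1 y v (bad_triangle_rot (bad_triangle_swap bad1)) e erefl cv vT c1K.
  by have := edge_deg_neq cC cv; rewrite d2 /d ecv -/(d c1 y) def_d.
have Ny w : adj y w -> w \notin T1 -> d w y = 2.
  by move=> yw wT; apply: (other y b1 c1) => //; apply: bad1.
(* Here [y] is the tail of exactly two edges, those to [b1] and [c1]; a third edge has its tail at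
   the outer end. *)
rewrite (_ : [set z in K | _] = [set b1; c1]) ?cards2 ?adj_neq //.
apply/setP => w; rewrite in_set in_set2; case: (boolP (w \in T1)) => [wT1|wT].
  have : [|| w == y, w == b1 | w == c1] by move: wT1; rewrite !inE -orbA.
  case/or3P=> /eqP ->.
  - by rewrite adj_irrefl andbF; apply/esym/negbTE; rewrite negb_or !adj_neq.
  - by rewrite b1K yb1 /tail mono // dby !eqxx.
  - by rewrite c1K yc1 /tail mono // dc1 !eqxx orbT.
have -> : (w == b1) || (w == c1) = false.
  by apply: contraNF wT; rewrite !inE -orbA => ->; rewrite orbT.
by apply/negP => /and3P [wK yw]; rewrite /tail mono // Ny.
Qed.

(** An edge of color degree 3 would produce an [escape] whose outgoing edge has degree 2 at both
    ends by [outer_edge_in]. So every vertex is the tail of just its edges of degree 2, an even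
    number by [even_pairs]. *)
Lemma obstruction : ~~ odd_edges C.
Proof.
have nomono y z : y \in C -> adj y z -> d y z != 3.
  move=> yC yz; apply/eqP => d3; have [deg3 tri] := mono_triangle yC yz d3.
  have [b0 [c0 bad0]] := all_bad yC deg3.
  have [b [c [x [[bad xT bx dbx] _]]]] := tri _ _ bad0; have [yb _ _ _] := bad.
  have bC := component_adj yC yb.
  have e : [set b; c; y] = [set y; b; c] by apply/setP => t; rewrite !inE -!orbA orbA orbC.
  have := outer_edge_in (leqnn _) bC (bad_triangle_rot bad); rewrite e => /(_ x xT bx) d2.
  by have := edge_deg_neq bC bx; rewrite dbx d2.
rewrite (odd_edges_orient (R := tail)) => [|y z yC _]; last exact: tail_asym.
rewrite odd_sum (_ : [set y in C | _] = set0) ?cards0 //.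
apply/setP => y; rewrite in_set in_set0; apply/negP => /andP [yC]; apply/negP.
rewrite (_ : [set z in C | _] = [set z | adj y z && (d y z == 2)]) ?even_pairs //.
apply/setP => z; rewrite !in_set; case yz: (adj y z); rewrite ?andbF //=.
by rewrite (component_adj yC yz) /tail (negPf (nomono y z yC yz)) orbF.
Qed.

End Obstruction.

(** * Assembling the components *)

(** Finiteness of [T] makes this constructive, without deciding [P]. *)
Lemma forall_or_left (T : finType) (P : Prop) (Q : T -> Prop) :
  (forall x, P \/ Q x) -> P \/ forall x, Q x.
Proof.
move=> PQ; suff [|H] : P \/ forall x, x \in enum T -> Q x; first by left.
  by right=> x; apply: H; rewrite mem_enum.
elim: (enum T) => [|y s [IHs|IHs]]; [by right|by left|].
by case: (PQ y) => [|Qy]; [left|right=> x; rewrite inE => /predU1P [->|/IHs]].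
Qed.

Section Components.
Variable G : sgraph.
Implicit Types x y r s : G.

Lemma connect_adj_sym : connect_sym (@adj G).
Proof. exact: sym_connect_sym (@adj_sym G). Qed.

Lemma component_eq r s : s \in component r -> component s = component r.
Proof.
rewrite mem_component => rs; apply/setP => x; rewrite !mem_component.
exact/esym/(same_connect connect_adj_sym rs).
Qed.

(** With an even number of edges any root works. Otherwise all roots are tried; if none works, all
    degrees are at most 3 and every vertex of degree 3 lies in a bad triangle, so [obstruction]
    contradicts the coloring [col]. *)
Lemma component_coloring r (T : eqType) (col : G -> G -> T) : cactus G ->
  li_coloring col (component r) ->
  exists col4 : G -> G -> 'I_4, li_coloring col4 (component r).
Proof.
move=> cactusG col_li; set C := component r.
case: (boolP (odd_edges C)) => oddC; last first.
  have [p [h [tree_ph cmp_p]]] := normal_tree_exists r.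
  apply: (tree_coloring tree_ph cmp_p cactusG (Sp := set0)).
  - by move=> v; rewrite inE.
  - by move=> w _; rewrite inE.
  by rewrite -(odd_edges_component tree_ph cmp_p) oddC cards0.
have [|//|H] := @forall_or_left G (exists col4 : G -> G -> 'I_4, li_coloring col4 C)
  (fun s => s \in C -> 3 <= deg s -> deg s = 3 /\
    ((forall x, x \in C -> deg x <= 3) -> exists b c, bad_triangle s b c)).
  move=> s; case: (boolP (s \in C)) => [sC|]; last by right.
  case: (leqP 3 (deg s)) => [deg3|]; last by right.
  have [p [h [tree_ph cmp_p]]] := normal_tree_exists s.
  have := root_coloring_or_bad tree_ph cmp_p cactusG; rewrite (component_eq sC).
  case=> // [|[deg_s [v [u [out1 vs upv uv /andP [nup b]]]]]]; [by left|right=> _ _].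
  split=> // deg_le3; exists v, u.
  by apply: (bad_root_triangle tree_ph cmp_p cactusG); rewrite ?(component_eq sC).
have deg_le3 x : x \in C -> deg x <= 3.
  move=> xC; rewrite leqNgt; apply/negP => lt3.
  by have [e _] := H x xC (ltnW lt3); rewrite e in lt3.
have := obstruction col_li deg_le3; rewrite oddC => obs; exfalso.
suff : ~~ true by []. apply: obs => x xC deg3.
by have [|_] := H x xC; [rewrite deg3|apply].
Qed.

Lemma li_coloring4 (T : eqType) (col : G -> G -> T) : cactus G ->
  li_coloring col setT -> exists col4 : G -> G -> 'I_4, li_coloring col4 setT.
Proof.
move=> cactusG [sym_col col_li].
have [r|F FP] := @fin_all_exists G (fun=> G -> G ->
  'I_4) (fun r f => li_coloring f (component r)).
  by apply: (component_coloring (col := col)) => //; split=> x y _;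
    [apply: sym_col|apply: col_li].
(* A canonical vertex of each component selects which of the colorings is used there. *)
pose rt := root (@adj G).
have x_rt x : x \in component (rt x) by rewrite mem_component connect_adj_sym connect_root.
have rtE x y : adj x y -> rt x = rt y by move=> xy; apply/eqP;
  rewrite root_connect ?connect1 //; exact: connect_adj_sym.
have degE x i : color_deg (fun x => F (rt x) x) x i = color_deg (F (rt x)) x i by [].
exists (fun x => F (rt x) x); split=> x y _ xy.
  by rewrite -(rtE x y xy); have [H _] := FP (rt x); apply: H.
by rewrite !degE -(rtE x y xy); have [_ H] := FP (rt x); apply: H.
Qed.

End Components.

(** * Edge colorings as symmetric functions on pairs of vertices *)

Section Liec.
Variable G : sgraph.
Implicit Types x y z : G.

(** [P] is the adjacency of the edge-induced subgraph read on all of [G]. Vertices outside the cover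
    have no [P]-neighbours, so degrees agree. *)
Lemma edge_induced_li (F : {set {set G}}) (P : rel G) :
    (forall x y, (x != y) && ([set x; y] \in F) = P x y) ->
  reflect (forall x y, P x y -> #|[set z | P x z]| != #|[set z | P y z]|)
    (locally_irregular (edge_induced F)).
Proof.
move=> FP; have Psym x y : P x y = P y x by rewrite -!FP eq_sym setUC.
have coverP x y : P x y -> x \in cover F.
  by rewrite -FP => /andP [_ xyF]; apply/bigcupP; exists [set x; y]; rewrite ?set21.
have degE (X : edge_induced F) : deg X = #|[set z | P (val X) z]|.
  rewrite /deg -(card_imset _ val_inj); apply: eq_card => z; rewrite [RHS]inE.
  apply/imsetP/idP => [[Y XY ->]|xz]; first by move: XY; rewrite inE /= /induced_adj /= FP.
  have zF : z \in cover F by apply: (coverP z (val X)); rewrite Psym.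
  by exists (Sub z zF); rewrite ?SubK // inE /= /induced_adj /= FP.
apply: (iffP forallP) => [li x y xy|H X].
  have xF := coverP _ _ xy; have yF : y \in cover F by apply: (coverP y x); rewrite Psym.
  have /forallP/(_ (Sub y yF))/implyP := li (Sub x xF).
  by rewrite !degE /= /induced_adj /= FP; apply.
apply/forallP => Y; apply/implyP; rewrite !degE /= /induced_adj /= FP; exact: H.
Qed.

Lemma mem_edges x y : ([set x; y] \in edges G) = adj x y.
Proof.
apply/imsetP/idP => [[[z t] /=]|xy]; last by exists (x, y); rewrite // inE.
rewrite inE /= => zt /set2_eq [[-> ->]|[-> ->]] //; by rewrite adj_sym.
Qed.

Lemma mem_color_class k (c : {ffun edge G -> 'I_k}) i (A : {set G}) :
  (A \in color_class c i) = (omap c (insub A) == Some i).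
Proof.
apply/imsetP/eqP => [[a + ->]|]; first by rewrite inE valK /= => /eqP ->.
by case: insubP => //= a _ <- [ci]; exists a; rewrite // inE ci.
Qed.

(** The value [None] is for pairs that are not edges. *)
Lemma liec_li_coloring k : has_liec G k ->
  exists col : G -> G -> option 'I_k, li_coloring col setT.
Proof.
case/existsP=> c /forallP c_li.
exists (fun x y => omap c (insub [set x; y])); split=> x y _ xy; first by rewrite setUC.
have xyE : [set x; y] \in edges G by rewrite mem_edges.
rewrite (insubT (fun A => A \in edges G) xyE) /=; set i := c _.
apply: (elimT (edge_induced_li (P := fun x y => adj x y && (omap c (insub [set x;
  y]) == Some i)) _) (c_li i)).
  move=> z t; rewrite mem_color_class; case: insubP => [a|/=]; last by rewrite !andbF.
  by rewrite mem_edges => zt _; rewrite zt (adj_neq zt).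
by rewrite xy (insubT (fun A => A \in edges G) xyE) /=.
Qed.

Lemma li_coloring_liec k (col : G -> G -> 'I_k) : li_coloring col setT -> has_liec G k.
Proof.
case=> sym_col col_li.
have pickE (a : edge G) : exists p : G * G, adj p.1 p.2 && (val a == [set p.1; p.2]).
  by have /imsetP [p] := valP a; rewrite inE => pE ->; exists p; rewrite pE eqxx.
(* The order in which the ends of an edge are chosen does not matter, because [col] is symmetric. *)
pose c := [ffun a : edge G => let p := xchoose (pickE a) in col p.1 p.2].
have cE x y (a : edge G) : adj x y -> val a = [set x; y] -> c a = col x y.
  move=> xy ea; rewrite ffunE /=.
  case: (xchoose (pickE a)) (xchooseP (pickE a)) => z t /andP [/= zt /eqP].
  by rewrite ea => /set2_eq [[-> ->] //|[-> ->]]; apply: sym_col.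
apply/existsP; exists c; apply/forallP => i.
apply/(edge_induced_li (P :=
  fun x y => adj x y && (col x y == i))) => [x y|x y /andP [xy /eqP <-]].
  rewrite mem_color_class; case: insubP => [a|]; rewrite mem_edges => xy.
    by move=> ea; rewrite /= (cE x y) // xy (adj_neq xy).
  by rewrite /= andbF (negPf xy).
exact: col_li.
Qed.

End Liec.

Theorem theorem10 (G : sgraph) (hG : colorable G) (hcactus : cactus G) :
  chi_irr hG <= 4.
Proof.
have [k /liec_li_coloring [col col_li]] := hG.
have [col4 /li_coloring_liec col4_li] := li_coloring4 hcactus col_li.
by rewrite /chi_irr; case: ex_minnP => m _; apply.
Qed.
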